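(* Let $A$ be an alphabet and let $K$ be one of $K_1$, $K_2$, $K_3$. The quantitative language-equivalence problem for weighted Büchi automata over $K$ and $A$ is decidable: there is an algorithm that, given weighted Büchi automata $\mathcal{N},\widehat{\mathcal{N}}$ over $K$ and $A$, decides whether $\|\mathcal{N}\|=\|\widehat{\mathcal{N}}\|$.
   Context: $\overline{\mathbb{Q}}=\mathbb{Q}\cup\{\infty,-\infty\}$ with its usual order. In each of $K_1,K_2,K_3$ the carrier is $\overline{\mathbb{Q}}$, addition (binary and infinitary) is $\sup$ with zero $-\infty$, product is $\inf$ with unit $\infty$; the $\omega$-valuation functions on sequences $(d_i)_{i\ge0}$ with finitely many values are: for $K_1$, $\mathrm{liminf}$: $-\infty$ if some $d_i=-\infty$; $\infty$ if all $d_i=\infty$; $\sup_{i\ge0}\inf\{d_k\mid k\ge i,d_k\ne\infty\}$ if no $-\infty$ and infinitely many $d_i\ne\infty$; $\inf\{d_i\mid d_i\ne\infty\}$ otherwise. For $K_2$, $\mathrm{limsup}$: same cases but with $\inf_{i\ge0}\sup\{d_k\mid k\ge i,d_k\ne\infty\}$ in the third case and $\sup\{d_i\mid d_i\ne\infty\}$ in the last. For $K_3$, $\sup_{-\infty}$: $-\infty$ if some $d_i=-\infty$; $\infty$ if all $d_i=\infty$; $\sup\{d_k\mid d_k\ne\infty\}$ otherwise. A weighted Büchi automaton over $A$ and $K$ is $(Q,wt,I,F)$ with finite $Q$, $wt:Q\times A\times Q\to\overline{\mathbb{Q}}$, $I,F\subseteq Q$; the weight of a path $(q_j,a_j,q_{j+1})_{j\ge0}$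 is the $\omega$-valuation of $(wt(q_j,a_j,q_{j+1}))_j$; a path is successful if $q_0\in I$ and some state of $F$ occurs infinitely often; the behavior $(\|\mathcal{A}\|,w)$ is the supremum of the weights of successful paths over $w$ ($-\infty$ if none). *)

(* Defs.v *)
From HB Require Import structures.
From mathcomp Require Import all_boot all_order all_algebra.
From Stdlib Require Import ClassicalEpsilon.

Set Implicit Arguments.
Unset Strict Implicit.
Unset Printing Implicit Defensive.

Import Order.TTheory GRing.Theory Num.Theory.

Inductive qbar := QNinf | QFin of rat | QInf.

Definition qbar_enc (x : qbar) : option (option rat) :=
  match x with QNinf => None | QFin q => Some (Some q) | QInf => Some None end.
Definition qbar_dec (o : option (option rat)) : qbar :=
  match o with None => QNinf | Some (Some q) => QFin q | Some None => QInf end.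
Lemma qbar_encK : cancel qbar_enc qbar_dec. Proof. by case. Qed.
HB.instance Definition _ := Countable.copy qbar (can_type qbar_encK).

Definition qle (x y : qbar) : bool :=
  match x, y with
  | QNinf, _ => true
  | _, QInf => true
  | QFin a, QFin b => (a <= b)%R
  | _, _ => false
  end.

Definition is_sup (S : qbar -> Prop) (s : qbar) : Prop :=
  (forall x, S x -> qle x s) /\ (forall u, (forall x, S x -> qle x u) -> qle s u).
Definition is_inf (S : qbar -> Prop) (s : qbar) : Prop :=
  (forall x, S x -> qle s x) /\ (forall u, (forall x, S x -> qle u x) -> qle u s).

(* supremum / infimum of a set of extended rationals (whenever it exists;
   in all uses below the sets have finitely many elements, so it does) *)
Definition qsup (S : qbar -> Prop) : qbar := epsilon (inhabits QNinf) (is_sup S).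
Definition qinf (S : qbar -> Prop) : qbar := epsilon (inhabits QNinf) (is_inf S).

Definition pdec (P : Prop) : bool := if excluded_middle_informative P then true else false.

Definition some_ninf (d : nat -> qbar) := exists i, d i = QNinf.
Definition all_inf (d : nat -> qbar) := forall i, d i = QInf.
Definition inf_often_fin (d : nat -> qbar) := forall i, exists k, (i <= k)%N /\ d k <> QInf.

Definition val_liminf (d : nat -> qbar) : qbar :=
  if pdec (some_ninf d) then QNinf
  else if pdec (all_inf d) then QInf
  else if pdec (inf_often_fin d) then
    qsup (fun x => exists i, x = qinf (fun y => exists k, (i <= k)%N /\ d k <> QInf /\ y = d k))
  else qinf (fun y => exists i, d i <> QInf /\ y = d i).

Definition val_limsup (d : nat -> qbar) : qbar :=
  if pdec (some_ninf d) then QNinf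
  else if pdec (all_inf d) then QInf
  else if pdec (inf_often_fin d) then
    qinf (fun x => exists i, x = qsup (fun y => exists k, (i <= k)%N /\ d k <> QInf /\ y = d k))
  else qsup (fun y => exists i, d i <> QInf /\ y = d i).

Definition val_supninf (d : nat -> qbar) : qbar :=
  if pdec (some_ninf d) then QNinf
  else if pdec (all_inf d) then QInf
  else qsup (fun y => exists k, d k <> QInf /\ y = d k).

(* the three valuation monoids K1, K2, K3 (all: carrier Qbar, sum = sup,
   zero = -oo, product = inf, unit = +oo; they differ by the valuation) *)
Inductive kind := K1 | K2 | K3.

Definition omega_val (K : kind) : (nat -> qbar) -> qbar :=
  match K with K1 => val_liminf | K2 => val_limsup | K3 => val_supninf end.

Definition wba_data (A : finType) (n : nat) : Type :=
  ({ffun 'I_n * A * 'I_n -> qbar} * {set 'I_n} * {set 'I_n})%type.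

Definition wba (A : finType) : Type := {n : nat & wba_data A n}.

Section Behavior.
Variables (A : finType) (K : kind).

Definition wba_wt (N : wba A) := (projT2 N).1.1.
Definition wba_init (N : wba A) := (projT2 N).1.2.
Definition wba_fin (N : wba A) := (projT2 N).2.

Definition path_weight (N : wba A) (w : nat -> A) (q : nat -> 'I_(projT1 N)) : qbar :=
  omega_val K (fun j => wba_wt N (q j, w j, q j.+1)).

Definition successful (N : wba A) (q : nat -> 'I_(projT1 N)) : Prop :=
  q 0%N \in wba_init N /\
  exists f, f \in wba_fin N /\ forall i, exists j, (i <= j)%N /\ q j = f.

(* behavior: supremum of weights of successful paths (-oo if none) *)
Definition behavior (N : wba A) (w : nat -> A) : qbar :=
  qsup (fun x => exists q : nat -> 'I_(projT1 N), @successful N q /\ x = @path_weight N w q).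
End Behavior.

Inductive recfun :=
| RZero
| RSucc
| RProj of nat
| RComp of recfun & list recfun
| RPrec of recfun & recfun
| RMu of recfun.

Inductive eval : recfun -> seq nat -> nat -> Prop :=
| eZero v : eval RZero v 0
| eSucc x v : eval RSucc (x :: v) x.+1
| eProj i v : (i < size v)%N -> eval (RProj i) v (nth 0%N v i)
| eComp f gs v ws y : evals gs v ws -> eval f ws y -> eval (RComp f gs) v y
| ePrec0 f g v y : eval f v y -> eval (RPrec f g) (0%N :: v) y
| ePrecS f g n v r y :
    eval (RPrec f g) (n :: v) r -> eval g (n :: r :: v) y -> eval (RPrec f g) (n.+1 :: v) y
| eMu f v n :
    eval f (n :: v) 0 -> (forall m, (m < n)%N -> exists k, eval f (m :: v) k.+1) ->
    eval (RMu f) v n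
with evals : seq recfun -> seq nat -> seq nat -> Prop :=
| esNil v : evals [::] v [::]
| esCons g gs v w ws : eval g v w -> evals gs v ws -> evals (g :: gs) v (w :: ws).

(* codes of automata, via the canonical (computable) countType encoding *)
Definition code (A : finType) (N : wba A) : nat := pickle N.

(* Main.v *)
(* Fix a threshold x > -oo. Whether a successful path of weight at least x reads w depends only on
   which of finitely many features (weight -oo, finite weight >= x, finite weight < x, final state)
   occur at all and which occur infinitely often, so "behavior N w >= x" is a Muller-type condition.
   A finite word acts on an automaton through its profile: the set of triples (p, q, S) such that
   some run from p to q over the word shows exactly the features S. Profiles compose, so by additive
   Ramsey every w factors as u v1 v2 ... with all v_i of one idempotent profile, and whether w is
   accepted depends on the profiles of u and v1 only. By pigeonhole these are also profiles of words
   of bounded length, hence two behaviors agree iff they agree, for each weight x of either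
   automaton, on all lassos u v v v ... with u and v short. On such a lasso acceptance amounts to a
   single loop over a bounded power of v, which is a finite search. The resulting formula, in which
   words and runs are numbers read digit by digit, is recursive in the codes. *)
Require Import Defs.
From mathcomp Require Import all_boot all_order all_algebra.
From mathcomp Require Import zify.
From Stdlib Require Import ClassicalEpsilon FunctionalExtensionality.

Set Implicit Arguments.
Unset Strict Implicit.
Unset Printing Implicit Defensive.

(** * Total recursive functions *)

Definition computable k (f : seq nat -> nat) :=
  exists e, forall v, size v = k -> eval e v (f v).

Definition computableb k (p : seq nat -> bool) := computable k (fun v => p v).

Lemma computable_ext k f g :
  (forall v, size v = k -> f v = g v) -> computable k f -> computable k g.
Proof. by move=> fg [e ef]; exists e => v sv; rewrite -fg //; apply: ef. Qed.

Lemma evals_proj v a n : a + n <= size v ->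
  evals [seq RProj i | i <- iota a n] v [seq nth 0 v i | i <- iota a n].
Proof.
elim: n a => [|n IH] a le_an /=; first exact: esNil.
by apply: esCons; [apply: eProj|apply: IH]; lia.
Qed.

Lemma computable_zero k : computable k (fun=> 0).
Proof. by exists RZero => v _; apply: eZero. Qed.

Lemma computable_head k : computable k.+1 (head 0).
Proof. by exists (RProj 0); case=> // x v _; apply: (@eProj 0 (x :: v)). Qed.

Lemma computable_behead k f :
  computable k f -> computable k.+1 (fun v => f (behead v)).
Proof.
case=> e ef; exists (RComp e [seq RProj i | i <- iota 1 k]) => v sv.
apply: eComp (evals_proj _) _; first by rewrite sv.
suff -> : [seq nth 0 v i | i <- iota 1 k] = behead v.
  by apply: ef; rewrite size_behead sv.
case: v sv => // x v [<-] /=.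
by rewrite (iotaDl 1) -map_comp -[RHS](mkseq_nth 0).
Qed.

(** Substitution for the innermost variable: the value of [f] is pushed in front of the environment,
    which the projections copy unchanged. *)
Lemma computable_let k F f :
  computable k.+1 (fun v => F (head 0 v) (behead v)) -> computable k f ->
  computable k (fun v => F (f v) v).
Proof.
move=> [e eF] [e' ef]; exists (RComp e (e' :: [seq RProj i | i <- iota 0 k])) => v sv.
apply: (@eComp _ _ _ (f v :: v)); last by apply: (eF (f v :: v)); rewrite /= sv.
apply: esCons; first exact: ef.
suff {2}-> : v = [seq nth 0 v i | i <- iota 0 k] by apply: evals_proj; rewrite sv.
by rewrite -sv [RHS](mkseq_nth 0).
Qed.

Lemma computable_succ k f : computable k f -> computable k (fun v => (f v).+1).
Proof.
move=> cf; apply: (@computable_let k (fun x _ => x.+1)) cf.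
exists RSucc; case=> // x v _; exact: eSucc.
Qed.

Lemma computable_rec k n b s :
  computable k n -> computable k b ->
  computable k.+2 (fun v => s (head 0 v) (head 0 (behead v)) (behead (behead v))) ->
  computable k (fun v => nat_rect (fun=> nat) (b v) (fun i r => s i r v) (n v)).
Proof.
move=> cn [eb hb] [es hs].
(* [RPrec] recurses on its first argument, so the bound is first pushed onto the environment. *)
apply: (@computable_let k
  (fun m v => nat_rect (fun=> nat) (b v) (fun i r => s i r v) m)) cn.
exists (RPrec eb es); case=> // m v [sv] /=.
elim: m => [|m IH] /=; first by apply: ePrec0; apply: hb.
by apply: ePrecS IH _; apply: (hs [:: m, _ & v]); rewrite /= sv.
Qed.

(* An environment lists the variables in scope, innermost first: the variable bound i binders above
   is [head 0] after i uses of [behead], and [f] under one more binder is [fun v => f (behead v)]. *)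
Ltac shifted H n :=
  first [ exact H
        | lazymatch n with S ?m => shifted open_constr:(computable_behead H) m end ].
Ltac computable_leaf :=
  lazymatch goal with
  | H : computable ?k ?f |- computable ?k ?f => exact H
  | H : computableb ?k ?f |- computableb ?k ?f => exact H
  | |- computable _ (head 0) => exact: computable_head
  | |- computable _ (fun v => head 0 (@?g v)) => shifted open_constr:(@computable_head _) 9
  | H : computable _ ?f |- computable _ (fun v => ?f (@?g v)) => shifted H 9
  | H : computableb _ ?p |- computableb _ (fun v => ?p (@?g v)) => shifted H 9
  | H : computableb _ ?p |- computable _ (fun v => nat_of_bool (?p (@?g v))) => shifted H 9
  end.

Lemma computable_const k n : computable k (fun=> n).
Proof. by elim: n => [|n]; [exact: computable_zero|exact: computable_succ]. Qed.

Lemma computable_add k f g : computable k f -> computable k g ->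
  computable k (fun v => f v + g v).
Proof.
move=> cf cg; apply: (@computable_ext _
  (fun v => nat_rect (fun=> nat) (g v) (fun i r => r.+1) (f v))).
  by move=> v _; elim: (f v) => //= m ->.
apply: (computable_rec (s := fun i r v => r.+1)) => //.
by apply: computable_succ; computable_leaf.
Qed.

Lemma computable_mul k f g : computable k f -> computable k g ->
  computable k (fun v => f v * g v).
Proof.
move=> cf cg; apply: (@computable_ext _
  (fun v => nat_rect (fun=> nat) 0 (fun i r => g v + r) (f v))).
  by move=> v _; elim: (f v) => //= m ->; rewrite mulSn.
apply: (computable_rec (s := fun i r v => g v + r)) => //; first exact: computable_zero.
by apply: computable_add; computable_leaf.
Qed.

Lemma computable_exp k f g : computable k f -> computable k g ->
  computable k (fun v => f v ^ g v).
Proof.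
move=> cf cg; apply: (@computable_ext _
  (fun v => nat_rect (fun=> nat) 1 (fun i r => f v * r) (g v))).
  by move=> v _; elim: (g v) => //= m ->; rewrite expnS.
apply: (computable_rec (s := fun i r v => f v * r)) => //; first exact: computable_const.
by apply: computable_mul; computable_leaf.
Qed.

Lemma computable_pred k f : computable k f -> computable k (fun v => (f v).-1).
Proof.
move=> cf; apply: (@computable_ext _
  (fun v => nat_rect (fun=> nat) 0 (fun i r => i) (f v))); first by move=> v _; case: (f v).
apply: (computable_rec (s := fun i r v => i)) => //; first exact: computable_zero.
computable_leaf.
Qed.

Lemma computable_sub k f g : computable k f -> computable k g ->
  computable k (fun v => f v - g v).
Proof.
move=> cf cg; apply: (@computable_ext _
  (fun v => nat_rect (fun=> nat) (f v) (fun i r => r.-1) (g v))).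
  by move=> v _; elim: (g v) => /= [|m ->]; rewrite ?subn0 ?subnS.
apply: (computable_rec (s := fun i r v => r.-1)) => //.
by apply: computable_pred; computable_leaf.
Qed.

Lemma computable_if k (p : seq nat -> bool) f g :
  computableb k p -> computable k f -> computable k g ->
  computable k (fun v => if p v then f v else g v).
Proof.
move=> cp cf cg; apply: (@computable_ext _
  (fun v => nat_rect (fun=> nat) (g v) (fun i r => f v) (p v))).
  by move=> v _; case: (p v).
by apply: (computable_rec (s := fun i r v => f v)) => //; computable_leaf.
Qed.

Lemma computableb_leq k f g : computable k f -> computable k g ->
  computableb k (fun v => f v <= g v).
Proof.
move=> cf cg; apply: (@computable_ext _ (fun v => 1 - (f v - g v))).
  by move=> v _; case: leqP; lia.
by apply: computable_sub; [exact: computable_const|exact: computable_sub].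
Qed.

Lemma computableb_neg k p : computableb k p -> computableb k (fun v => ~~ p v).
Proof.
move=> cp; apply: (@computable_ext _ (fun v => 1 - p v)); first by move=> v _; case: (p v).
by apply: computable_sub => //; exact: computable_const.
Qed.

Lemma computableb_and k p q :
  computableb k p -> computableb k q -> computableb k (fun v => p v && q v).
Proof.
move=> cp cq; apply: (@computable_ext _ (fun v => p v * q v)); last exact: computable_mul.
by move=> v _; rewrite mulnb.
Qed.

Lemma computableb_or k p q :
  computableb k p -> computableb k q -> computableb k (fun v => p v || q v).
Proof.
move=> cp cq; apply: (@computable_ext _ (fun v => ~~ (~~ p v && ~~ q v))).
  by move=> v _; rewrite negb_and !negbK.
by apply: computableb_neg; apply: computableb_and; apply: computableb_neg.
Qed.

Lemma computableb_eq k f g : computable k f -> computable k g ->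
  computableb k (fun v => f v == g v).
Proof.
move=> cf cg; apply: (@computable_ext _ (fun v => (f v <= g v) && (g v <= f v))).
  by move=> v _; rewrite eqn_leq.
by apply: computableb_and; apply: computableb_leq.
Qed.

Lemma computableb_eqb k p q :
  computableb k p -> computableb k q -> computableb k (fun v => p v == q v).
Proof.
move=> cp cq; apply: (@computable_ext _ (fun v => (p v : nat) == (q v : nat))).
  by move=> v _; case: (p v); case: (q v).
exact: computableb_eq.
Qed.

Lemma computable_count k (p : nat -> seq nat -> bool) n :
  computableb k.+1 (fun v => p (head 0 v) (behead v)) -> computable k n ->
  computable k (fun v => count (fun i => p i v) (iota 0 (n v))).
Proof.
move=> cp cn; apply: (@computable_ext _
  (fun v => nat_rect (fun=> nat) 0 (fun i r => r + p i v) (n v))).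
  move=> v _; elim: (n v) => // m IH.
  by rewrite -addn1 iotaD count_cat /= addn0 -IH addn1.
apply: (computable_rec (s := fun i r v => r + p i v)) => //; first exact: computable_zero.
apply: computable_add; first by computable_leaf.
(* The loop body runs in the environment [i :: r :: v], whereas [p] expects [i :: v]. A second copy
   of [i] is pushed, and the projections below keep it while skipping the old [i] and [r]. *)
apply: (@computable_let _ (fun x v => p x (behead (behead v)))); last by computable_leaf.
apply: (@computable_ext _ (fun v =>
  (fun x w => (p x w : nat)) (head 0 v) (behead (behead (behead v))))) => //.
case: cp => e ep; exists (RComp e (RProj 0 :: [seq RProj i | i <- iota 3 k])) => v sv.
apply: (@eComp _ _ _ (head 0 v :: behead (behead (behead v)))).
  apply: esCons; first by rewrite -nth0; apply: eProj; rewrite sv.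
  suff -> : behead (behead (behead v)) = [seq nth 0 v i | i <- iota 3 k].
    by apply: evals_proj; rewrite sv.
  case: v sv => // x [|y [|z v]] //= [<-].
  by rewrite (iotaDl 3) -map_comp -[LHS](mkseq_nth 0).
by apply: (ep (_ :: _)); rewrite /= !size_behead sv.
Qed.

Lemma computableb_has k (p : nat -> seq nat -> bool) n :
  computableb k.+1 (fun v => p (head 0 v) (behead v)) -> computable k n ->
  computableb k (fun v => has (fun i => p i v) (iota 0 (n v))).
Proof.
move=> cp cn; apply: (@computable_ext _
  (fun v => 0 < count (fun i => p i v) (iota 0 (n v)))).
  by move=> v _; rewrite has_count.
by apply: computableb_leq; [exact: computable_const|exact: computable_count].
Qed.

Lemma computableb_all k (p : nat -> seq nat -> bool) n :
  computableb k.+1 (fun v => p (head 0 v) (behead v)) -> computable k n ->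
  computableb k (fun v => all (fun i => p i v) (iota 0 (n v))).
Proof.
move=> cp cn; apply: (@computable_ext _
  (fun v => ~~ has (fun i => ~~ p i v) (iota 0 (n v)))).
  by move=> v _; rewrite has_predC negbK.
by apply: computableb_neg; apply: computableb_has => //; apply: computableb_neg.
Qed.

Lemma computable_iter k (F : nat -> seq nat -> nat) n b :
  computable k.+1 (fun v => F (head 0 v) (behead v)) ->
  computable k n -> computable k b ->
  computable k (fun v => iter (n v) (fun x => F x v) (b v)).
Proof.
move=> cF cn cb; apply: (@computable_ext _
  (fun v => nat_rect (fun=> nat) (b v) (fun i r => F r v) (n v))).
  by move=> v _; elim: (n v) => //= m ->.
apply: (computable_rec (s := fun i r v => F r v)) => //.
exact: (@computable_behead k.+1 (fun v => F (head 0 v) (behead v))).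
Qed.

(** This turns a number into a bounded count, which is how division and [code_head] are seen to be
    recursive. *)
Lemma count_ltn m n : count (fun i => i < m) (iota 0 n) = minn m n.
Proof.
elim: n => [|n IH]; first by rewrite minn0.
rewrite -addn1 iotaD count_cat IH /= addn0; lia.
Qed.

Lemma computable_div k f g : computable k f -> computable k g ->
  computable k (fun v => f v %/ g v).
Proof.
(* For a zero divisor every index would pass the test and the count would be [f v], not the default
   quotient 0. *)
move=> cf cg; apply: (@computable_ext _ (fun v => if g v == 0 then 0 else
    count (fun i => i.+1 * g v <= f v) (iota 0 (f v)))).
  move=> v _; case: eqP => [->|/eqP]; first by rewrite divn0.
  rewrite -lt0n => g0; rewrite -[RHS](minn_idPl (leq_div (f v) (g v))) -count_ltn.
  by apply: eq_count => i; rewrite leq_divRL.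
apply: computable_if; last apply: (computable_count (p := fun i v => i.+1 * g v <= f v)) => //.
- by apply: computableb_eq => //; exact: computable_const.
- exact: computable_const.
- apply: computableb_leq; last by computable_leaf.
  by apply: computable_mul; last computable_leaf; apply: computable_succ; computable_leaf.
Qed.

Lemma computable_mod k f g : computable k f -> computable k g ->
  computable k (fun v => f v %% g v).
Proof.
move=> cf cg; apply: (@computable_ext _ (fun v => f v - f v %/ g v * g v)).
  by move=> v _; rewrite {1}(divn_eq (f v) (g v)) addKn.
by apply: computable_sub => //; apply: computable_mul => //; apply: computable_div.
Qed.

Ltac compute_step :=
  lazymatch goal with
  | |- computable _ (fun _ => ?n) => exact: computable_const
  | |- computable _ (fun v => @?f v + @?g v) => apply: computable_add
  | |- computable _ (fun v => @?f v * @?g v) => apply: computable_mul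
  | |- computable _ (fun v => @?f v ^ @?g v) => apply: computable_exp
  | |- computable _ (fun v => @?f v - @?g v) => apply: computable_sub
  | |- computable _ (fun v => @?f v %/ @?g v) => apply: computable_div
  | |- computable _ (fun v => @?f v %% @?g v) => apply: computable_mod
  | |- computable _ (fun v => (@?f v).-1) => apply: computable_pred
  | |- computable _ (fun v => (@?f v).+1) => apply: computable_succ
  | |- computable _ (fun v => if _ then _ else _) => apply: computable_if
  | |- computableb _ (fun v => @?f v <= @?g v) => apply: computableb_leq
  | |- computableb _ (fun v => @?f v == @?g v) =>
      first [apply: computableb_eq | apply: computableb_eqb]
  | |- computableb _ (fun v => @?p v && @?q v) => apply: computableb_and
  | |- computableb _ (fun v => @?p v || @?q v) => apply: computableb_or
  | |- computableb _ (fun v => ~~ @?p v) => apply: computableb_neg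
  end.
Ltac compute_tac := repeat (compute_step || computable_leaf).

(** Digits are numbered from the least significant one; the numbers below [b ^ L] thus code the
    words of length [L] over [b] letters. *)
Definition dig b z j := z %/ b ^ j %% b.

Lemma computable_dig k b z j : computable k b -> computable k z -> computable k j ->
  computable k (fun v => dig (b v) (z v) (j v)).
Proof. by move=> *; rewrite /dig; compute_tac. Qed.

(** * Decoding automata *)

(* [CodeSeq.code (n :: s)] is [2 ^ n * (2 * CodeSeq.code s + 1)]. *)
Definition code_head x := count (fun j => x %% 2 ^ j.+1 == 0) (iota 0 x).
Definition code_behead x := (x %/ 2 ^ code_head x).-1 %/ 2.
Definition code_nth x i := code_head (iter i code_behead x).

Lemma code_head_cons n s : code_head (CodeSeq.code (n :: s)) = n.
Proof.
rewrite /code_head /=; set m := CodeSeq.code s; set N := 2 ^ n * _.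
(* The head is the 2-adic valuation of the code; as [n < 2 ^ n], counting exponents below the code
   misses none. *)
have lt_nN : n < N by rewrite /N (leq_trans (ltn_expl n (ltnSn 1))) // leq_pmulr.
rewrite -[RHS](minn_idPl (ltnW lt_nN)) -count_ltn; apply: eq_count => j /=.
rewrite -[_ == 0]/(2 ^ j.+1 %| N) /N.
case: (ltnP j n) => [lt_jn|le_nj]; first by rewrite dvdn_mulr // dvdn_exp2l.
rewrite -(subnKC (leq_trans le_nj (leqnSn j))) subSn // expnD dvdn_pmul2l ?expn_gt0 //.
apply/negbTE; rewrite expnS; apply/negP => /(dvdn_trans (dvdn_mulr _ (dvdnn 2))).
by rewrite dvdn2 /= odd_double.
Qed.

Lemma code_behead_cons n s : code_behead (CodeSeq.code (n :: s)) = CodeSeq.code s.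
Proof. by rewrite /code_behead code_head_cons /= mulKn ?expn_gt0 //= -muln2 mulnK. Qed.

(** Positions past the end are covered too: the empty list has code 0, whose head and tail are again
    0. *)
Lemma code_nthE s i : code_nth (CodeSeq.code s) i = nth 0 s i.
Proof.
elim: i s => [|i IH] [|n s] //; rewrite /code_nth ?iterSr ?code_behead_cons.
- exact: code_head_cons.
- by rewrite nth_nil -(nth_nil 0 i) -(IH [::]).
- exact: IH.
Qed.

Lemma computable_code_head k x : computable k x -> computable k (fun v => code_head (x v)).
Proof.
move=> cx; rewrite /code_head.
apply: (computable_count (p := fun j v => x v %% 2 ^ j.+1 == 0)) => //.
by compute_tac.
Qed.

Lemma computable_code_nth k x i : computable k x -> computable k i ->
  computable k (fun v => code_nth (x v) (i v)).
Proof.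
move=> cx ci; rewrite /code_nth; apply: computable_code_head.
apply: (computable_iter (F := fun y _ => code_behead y)) => //.
by rewrite /code_behead; compute_tac; apply: computable_code_head; compute_tac.
Qed.

Lemma index_allpairs (S T : eqType) (s : seq S) (t : seq T) x y : x \in s -> y \in t ->
  index (x, y) [seq (a, b) | a <- s, b <- t] = index x s * size t + index y t.
Proof.
move=> + yt; elim: s => //= a s IH; rewrite inE eq_sym index_cat size_map.
have index_row (b : S) : index (b, y) [seq (b, c) | c <- t] = index y t.
  by elim: (t) => //= c t' ->; rewrite xpair_eqE eqxx.
case: (eqVneq x a) => [-> _|ne_xa] /=.
  by rewrite map_f // index_row mul0n.
move=> xs; rewrite ifN ?IH //; first by rewrite mulSn addnA.
by apply/mapP => -[b _ [/eqP + _]]; rewrite (negbTE ne_xa).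
Qed.

(** Products are enumerated lexicographically, so the table of a transition function can be
    addressed arithmetically. *)
Lemma index_enum_pair (S T : finType) (x : S) (y : T) :
  index (x, y) (enum {: S * T}) = index x (enum S) * #|T| + index y (enum T).
Proof.
rewrite [enum {: S * T}]enumT unlock /= /prod_enum index_allpairs ?mem_enum //.
by rewrite -cardE.
Qed.

Lemma pickle_ffun (aT : finType) (T : countType) (f : {ffun aT -> T}) :
  pickle f = CodeSeq.code [seq CodeSeq.code [:: pickle x; pickle (f x)] | x <- enum aT].
Proof.
have -> : pickle f = CodeSeq.code (map pickle (val (tfgraph f))) by [].
rewrite -[val (tfgraph _)]codom_tffun /codom /image_mem.
by rewrite -(map_comp pickle (total_fun f)).
Qed.

(** The encoding of a finite function lists its graph; component 1 of an entry is the value,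
    component 0 the argument. *)
Definition code_app y i := code_nth (code_nth y i) 1.

Lemma code_app_ffun (aT : finType) (T : countType) (f : {ffun aT -> T}) x :
  code_app (pickle f) (index x (enum aT)) = pickle (f x).
Proof.
rewrite /code_app pickle_ffun code_nthE (nth_map x) ?index_mem ?mem_enum //.
by rewrite nth_index ?mem_enum // code_nthE.
Qed.

Lemma code_app_set (T : finType) (B : {set T}) x :
  code_app (pickle B) (index x (enum T)) = (x \in B).
Proof. by rewrite -[pickle B]/(pickle (val B)) code_app_ffun pred_of_set.unlock. Qed.

Section Automaton.
Variable a : nat.

Definition states c := code_nth c 0.
(** The projections follow the nesting [((W, I), F)] of the data, and the last argument is the rank
    of [(p, b, q)] among all triples. *)
Definition weight_code c p b q :=
  code_app (code_nth (code_nth (code_nth c 1) 0) 0) ((p * a + b) * states c + q).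
Definition is_init c p := code_app (code_nth (code_nth (code_nth c 1) 0) 1) p == 1.
Definition is_final c p := code_app (code_nth (code_nth c 1) 1) p == 1.

Section Computable.
Variables (k : nat) (c p b q : seq nat -> nat).
Hypotheses (cc : computable k c) (cp : computable k p) (cb : computable k b) (cq : computable k q).

Lemma computable_states : computable k (fun v => states (c v)).
Proof. by apply: computable_code_nth; compute_tac. Qed.

Lemma computable_weight : computable k (fun v => weight_code (c v) (p v) (b v) (q v)).
Proof.
by rewrite /weight_code /code_app /states; repeat (apply: computable_code_nth || compute_tac).
Qed.

Lemma computableb_init : computableb k (fun v => is_init (c v) (p v)).
Proof.
by rewrite /is_init /code_app; compute_tac; repeat (apply: computable_code_nth || compute_tac).
Qed.

Lemma computableb_final : computableb k (fun v => is_final (c v) (p v)).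
Proof.
by rewrite /is_final /code_app; compute_tac; repeat (apply: computable_code_nth || compute_tac).
Qed.
End Computable.
End Automaton.

Section AutomatonSpec.
Variables (A : finType) (N : wba A).

Lemma codeE : code N = CodeSeq.code [:: projT1 N; CodeSeq.code
  [:: CodeSeq.code [:: pickle (wba_wt N); pickle (wba_init N)]; pickle (wba_fin N)]].
Proof. by case: N => [n [[W I] F]]. Qed.

Lemma states_code : states (code N) = projT1 N.
Proof. by rewrite /states codeE code_nthE. Qed.

Lemma weight_code_code (p q : 'I_(projT1 N)) b :
  weight_code #|A| (code N) p (index b (enum A)) q = pickle (wba_wt N (p, b, q)).
Proof.
rewrite /weight_code states_code codeE !code_nthE -code_app_ffun; congr code_app.
by rewrite !index_enum_pair !card_ord !index_enum_ord.
Qed.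

Lemma is_init_code (p : 'I_(projT1 N)) : is_init (code N) p = (p \in wba_init N).
Proof.
rewrite /is_init codeE !code_nthE -[X in code_app _ X]index_enum_ord.
by rewrite code_app_set; case: (_ \in _).
Qed.

Lemma is_final_code (p : 'I_(projT1 N)) : is_final (code N) p = (p \in wba_fin N).
Proof.
rewrite /is_final codeE !code_nthE -[X in code_app _ X]index_enum_ord.
by rewrite code_app_set; case: (_ \in _).
Qed.
End AutomatonSpec.

(* [Posz n] and [Negz n] are pickled as the codes of [[:: code [:: n]; 0]] and [[:: 0; code [:: n]]]. *)
Definition pos_part z := if code_nth z 0 == 0 then 0 else code_nth (code_nth z 0) 0.
Definition neg_part z := if code_nth z 0 == 0 then (code_nth (code_nth z 1) 0).+1 else 0.

Lemma pos_neg_partE (z : int) :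
  z = ((pos_part (pickle z))%:Z - (neg_part (pickle z))%:Z)%R.
Proof.
rewrite /pos_part /neg_part; case: z => n.
  have -> : pickle (Posz n) = CodeSeq.code [:: CodeSeq.code [:: n]; 0] by [].
  have nz : (CodeSeq.code [:: n] == 0) = false by rewrite /= muln_eq0 expn_eq0.
  rewrite !(code_nthE [:: CodeSeq.code [:: n]; 0]) -[nth _ _ 0]/(CodeSeq.code [:: n]).
  by rewrite nz code_nthE GRing.subr0.
have -> : pickle (Negz n) = CodeSeq.code [:: 0; CodeSeq.code [:: n]] by [].
by rewrite !code_nthE GRing.sub0r NegzE.
Qed.

(** The two outer layers come from the options of [qbar_enc], the inner one from the pair of
    numerator and denominator. *)
Definition code_num y := code_nth (code_nth (code_nth y 0) 0) 0.
Definition code_den y := code_nth (code_nth (code_nth y 0) 0) 1.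

(** Codes 0 and 1 are those of -oo and +oo. Finite values are compared by cross-multiplication, with
    negative parts moved to the other side to stay within natural numbers; denominators are
    positive. *)
Definition qle_code x y :=
  (x == 0) || (y == 1) ||
  [&& x != 1, y != 0 &
    pos_part (code_num x) * pos_part (code_den y) +
    neg_part (code_num y) * pos_part (code_den x) <=
    pos_part (code_num y) * pos_part (code_den x) +
    neg_part (code_num x) * pos_part (code_den y)].

Lemma pickle_qninf : pickle QNinf = 0. Proof. by []. Qed.
Lemma pickle_qinf : pickle QInf = 1. Proof. by []. Qed.

Lemma qle_codeE x y : qle_code (pickle x) (pickle y) = qle x y.
Proof.
have finE r : pickle (QFin r) = CodeSeq.code
   [:: CodeSeq.code [:: CodeSeq.code [:: pickle (numq r); pickle (denq r)]]] by [].
have fin_gt1 r : 1 < pickle (QFin r).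
  by rewrite finE /= !muln1 -{1}(expn0 2) ltn_exp2l // expn_gt0.
have numE r : code_num (pickle (QFin r)) = pickle (numq r).
  by rewrite /code_num finE !code_nthE.
have denE r : code_den (pickle (QFin r)) = pickle (denq r).
  by rewrite /code_den finE !code_nthE.
have den_pos t : denq t = Posz (pos_part (pickle (denq t))).
  have := denq_gt0 t; have := pos_neg_partE (denq t); rewrite /neg_part /pos_part.
  by case: eqP => _; lia.
(* Unification must not unfold the encoding. *)
have := pickle_qninf; have := pickle_qinf; move: fin_gt1 numE denE {finE}.
move: (@pickle qbar) => f fin_gt1 numE denE inf1 ninf0.
case: x => [|r|]; case: y => [|s|]; rewrite /qle_code ?ninf0 ?inf1 ?eqxx ?orbT //=;
  rewrite ?(gtn_eqF (fin_gt1 _)) ?(gtn_eqF (ltnW (fin_gt1 _))) //=.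
rewrite !numE !denE.
have -> : (r <= s)%R = (numq r * denq s <= numq s * denq r)%R by rewrite -rat.le_ratE.
move: (pos_neg_partE (numq r)) (pos_neg_partE (numq s)) (den_pos r) (den_pos s).
move: (pos_part _) (pos_part _) (pos_part _) (pos_part _) (neg_part _) (neg_part _).
by move=> ? ? ? ? ? ? -> -> -> ->; nia.
Qed.

(** * Muller automata and profiles *)

Lemma pdecP (P : Prop) : reflect P (pdec P).
Proof. by rewrite /pdec; case: excluded_middle_informative => ?; constructor. Qed.

Lemma choice_fun S T (R : S -> T -> Prop) :
  (forall x, exists y, R x y) -> exists f, forall x, R x (f x).
Proof.
move=> ex; exists (fun x => proj1_sig (constructive_indefinite_description _ (ex x))) => x.
by case: constructive_indefinite_description.
Qed.

Lemma finite_bound (C : finType) (P : C -> nat -> Prop) :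
  (forall c m n, m <= n -> P c m -> P c n) -> (forall c, exists n, P c n) ->
  exists n, forall c, P c n.
Proof.
move=> mono /choice_fun[f Pf]; exists (\max_c f c) => c.
exact: mono (leq_bigmax c) (Pf c).
Qed.

Definition unbounded (P : nat -> Prop) := forall i, exists2 j, i <= j & P j.

(** Infinite pigeonhole principle: if every colour stopped occurring, a common bound would leave no
    colour for later positions. *)
Lemma unbounded_color (T : finType) (x : nat -> T) P :
  unbounded P -> exists t, unbounded (fun j => P j /\ x j = t).
Proof.
move=> infP; apply: NNPP => no_t.
have [n ub] : exists n, forall t j, n <= j -> P j -> x j <> t.
  apply: (@finite_bound _ (fun t n => forall j, n <= j -> P j -> x j <> t)).
    by move=> t m n le_mn ub j /(leq_trans le_mn); apply: ub.
  move=> t; apply: NNPP => no_n; apply: no_t; exists t => i.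
  apply: NNPP => no_j; apply: no_n; exists i => j le_ij Pj xj.
  by apply: no_j; exists j.
by have [j le_nj Pj] := infP n; apply: (ub (x j) j).
Qed.

Lemma pigeonhole (T : finType) (x : nat -> T) a :
  exists i j, [/\ a <= i < j, j <= a + #|T| & x i = x j].
Proof.
have /injectivePn[i [j ne_ij eq_ij]] : ~~ injectiveb (fun i : 'I_#|T|.+1 => x (a + i)).
  by apply/negP => /injectiveP /leq_card; rewrite card_ord ltnn.
have := ltn_ord i; have := ltn_ord j.
wlog lt_ij : i j ne_ij eq_ij / i < j => [th|].
  move: (ne_ij); rewrite -val_eqE neq_ltn => /orP[] lt_ij; first exact: (th i j).
  by move=> ? ?; apply: (th j i); rewrite // eq_sym.
move=> ? ?; exists (a + i), (a + j); split=> //; last by rewrite leq_add2l -ltnS.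
by rewrite leq_addr ltn_add2l.
Qed.

(** By pigeonhole the powers are periodic from some exponent on, and an exponent in the periodic
    range that is a multiple of the period is idempotent. *)
Lemma idempotent_power (T : finType) (mul : T -> T -> T) (x : nat -> T) :
  (forall i j, 0 < i -> 0 < j -> x (i + j) = mul (x i) (x j)) ->
  exists l, [/\ 0 < l, l <= #|T| & mul (x l) (x l) = x l].
Proof.
move=> xD; have [i [j [/andP[i_gt0 lt_ij] le_jT eq_ij]]] := pigeonhole x 1.
set p := j - i; have p_gt0 : 0 < p by rewrite subn_gt0.
have period t : i <= t -> x (t + p) = x t.
  move=> le_it; rewrite -(subnKC le_it); case: (posnP (t - i)) => [->|t_gt].
    by rewrite addn0 subnKC // ltnW.
  rewrite (_ : _ + p = j + (t - i)); last lia.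
  by rewrite xD -?eq_ij -?xD //; lia.
(* Among [p] consecutive numbers one is a multiple of [p]; the upper end [i + p.-1] is [j.-1], hence
   at most [#|T|]. *)
have [n le_i le_np] : exists2 n, i <= n * p & n * p <= i + p.-1.
  exists ((i + p.-1) %/ p); last exact: leq_trunc_div.
  have := divn_eq (i + p.-1) p; have := ltn_pmod (i + p.-1) p_gt0.
  by move: (_ %/ p) (_ %% p) => a b; lia.
have le_nT : n * p <= #|T|.
  by rewrite -(leq_add2l 1); apply: leq_trans _ le_jT; move: le_np; rewrite /p; lia.
exists (n * p); split=> //; first exact: leq_trans i_gt0 le_i.
rewrite -xD; [|exact: leq_trans i_gt0 le_i..].
elim: {2}n => [|d IH]; first by rewrite addn0.
by rewrite mulSn addnCA addnC period //; apply: leq_trans le_i _; exact: leq_addr.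
Qed.

(** * Ramsey's theorem for additive colourings *)

Section Ramsey.
Variables (T : finType) (mul : T -> T -> T) (c : nat -> nat -> T).
Hypothesis c_mul : forall i j k, i < j -> j < k -> c i k = mul (c i j) (c j k).

Let merge i j k := i < k /\ j < k /\ c i k = c j k.

Lemma merge_later i j k l : merge i j k -> k <= l -> c i l = c j l.
Proof.
move=> [ik [jk cij]]; rewrite leq_eqVlt => /orP[/eqP<-//|kl].
by rewrite (c_mul ik kl) (c_mul jk kl) cij.
Qed.

(* Otherwise one could pick more than #|T| pairwise non-merging positions, whose
   colours towards a common later position would be pairwise distinct. *)
Lemma unbounded_merge : exists i, unbounded (fun j => exists k, merge i j k).
Proof.
apply: NNPP => no_i.
have /choice_fun[b bP] i : exists b, forall j, b <= j -> ~ exists k, merge i j k.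
  apply: NNPP => no_b; apply: no_i; exists i => b.
  apply: NNPP => no_j; apply: no_b; exists b => j le_bj mj.
  by apply: no_j; exists j.
(* [B n] exceeds [n] and lies beyond all merging partners of the positions up to [n], so no two
   terms of [g] merge. *)
pose B n := maxn n.+1 (\max_(i < n.+1) b i).
pose g n := iter n B 0.
have ltg : {homo g : m n / m < n}.
  by apply: homo_ltn => [? ? ?|n]; [exact: ltn_trans|rewrite /g /= /B leq_max leqnn].
have leg m n : m < n -> b (g m) <= g n.
  case: n => // n; rewrite ltnS => le_mn; rewrite /g iterS -/(g n) /B leq_max.
  have le_g : g m < (g n).+1.
    by move: le_mn; rewrite leq_eqVlt ltnS => /orP[/eqP->//|/ltg/ltnW].
  by rewrite (leq_bigmax (F := fun i : 'I__ => b i) (Ordinal le_g)) orbT.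
have [m [n [/andP[_ lt_mn] le_n eq_mn]]] :=
  pigeonhole (fun i => c (g i) (g #|T|.+1)) 0.
apply: (bP (g m) (g n) (leg _ _ lt_mn)); exists (g #|T|.+1).
by split; [|split]=> //; apply: ltg; lia.
Qed.

(** Some [i0] merges with infinitely many positions, infinitely many of which have the same colours
    [s] from 0 and [e] from [i0]. If [h i] has merged with [i0] before [h j], its colour towards
    [h j] is that of [i0], namely [e]. *)
Lemma additive_ramsey : exists h s e, [/\ 0 < h 0, {homo h : i j / i < j},
  forall i, c 0 (h i) = s & forall i j, i < j -> c (h i) (h j) = e].
Proof.
have [i0 inf_i0] := unbounded_merge.
have [[s e] inf_se] := unbounded_color (fun j => (c 0 j, c i0 j)) inf_i0.
have /choice_fun[nx nxP] b : exists j, b <= j /\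
    (exists k, merge i0 j k) /\ (c 0 j, c i0 j) = (s, e).
  by have [j le_bj [? ?]] := inf_se b; exists j.
have /choice_fun[mg mgP] j : exists k, (exists l, merge i0 j l) -> merge i0 j k.
  by case: (classic (exists l, merge i0 j l)) => [[l ml]|no_l]; [exists l|exists 0].
(* The next position is taken after [x] has merged with [i0]; starting from [nx 1] makes [h 0]
   positive. *)
pose B x := nx (maxn x.+1 (mg x)); pose h n := iter n B (nx 1).
have hP n : (exists k, merge i0 (h n) k) /\ (c 0 (h n), c i0 (h n)) = (s, e).
  by case: n => [|n]; [case: (nxP 1)|rewrite /h iterS /B; case: (nxP (maxn (h n).+1 (mg (h n))))].
have hS n : h n < h n.+1 /\ mg (h n) <= h n.+1.
  by case: (nxP (maxn (h n).+1 (mg (h n)))); rewrite -/(B _) -/(h n.+1) geq_max => /andP[].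
have lth : {homo h : m n / m < n}.
  by apply: homo_ltn => [? ? ?|n]; [exact: ltn_trans|case: (hS n)].
exists h, s, e; split=> //.
- by case: (nxP 1).
- by move=> i; case: (hP i) => _ [].
move=> i j lt_ij; have [_ [_ <-]] := hP j.
rewrite (merge_later (mgP _ (hP i).1)) //.
apply: leq_trans (hS i).2 _.
by move: lt_ij; rewrite leq_eqVlt => /orP[/eqP->//|/lth/ltnW].
Qed.
End Ramsey.

(** * Muller automata, runs and profiles *)

(** In contrast to the usual Muller condition, [macc] also sees which features occur at all: a
    single weight -oo already decides the value of a path. *)
Record muller (A C : finType) := Muller {
  mstate :> finType;
  label : mstate -> A -> mstate -> {set C};
  minit : {set mstate};
  macc : {set C} -> {set C} -> bool }.

Definition profile_mul (Q C : finType) (s t : {set Q * Q * {set C}}) :=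
  [set x : Q * Q * {set C} | [exists y : Q * {set C} * {set C},
    [&& (x.1.1, y.1.1, y.1.2) \in s, (y.1.1, x.1.2, y.2) \in t & x.2 == y.1.2 :|: y.2]]].

Section Muller.
Variables (A C : finType) (M : muller A C).
Implicit Types (w : nat -> A) (r : nat -> M) (S : {set C}).

Definition features r w i j :=
  [set c | has (fun t => c \in label (r t) (w t) (r t.+1)) (index_iota i j)].

Definition accepts w := exists r S0 S1, [/\ r 0 \in minit M,
  forall c, c \in S0 <-> exists t, c \in label (r t) (w t) (r t.+1),
  forall c, c \in S1 <-> unbounded (fun t => c \in label (r t) (w t) (r t.+1)) &
  macc M S0 S1].

Lemma featuresP r w i j c : reflect
  (exists2 t, i <= t < j & c \in label (r t) (w t) (r t.+1)) (c \in features r w i j).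
Proof.
rewrite inE; apply: (iffP hasP) => -[t tij ct]; exists t => //; move: tij;
  by rewrite mem_index_iota.
Qed.

Lemma features_cat r w i j k : i <= j -> j <= k ->
  features r w i k = features r w i j :|: features r w j k.
Proof.
move=> ij jk; apply/setP => c; rewrite !inE -has_cat /index_iota; congr has.
by rewrite (_ : k - i = (j - i) + (k - j)) ?iotaD ?subnKC //; lia.
Qed.

Lemma eq_features r r' w i j : (forall t, i <= t <= j -> r t = r' t) ->
  features r w i j = features r' w i j.
Proof.
move=> rr'; apply/setP => c; rewrite !inE; apply: eq_in_has => t; rewrite mem_index_iota => ?.
by rewrite !rr' //; lia.
Qed.

Definition segment w i j p q S := exists r, [/\ r i = p, r j = q & features r w i j = S].

Definition profile w i j := [set x : M * M * {set C} | pdec (segment w i j x.1.1 x.1.2 x.2)].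

Lemma profileP w i j p q S : reflect (segment w i j p q S) ((p, q, S) \in profile w i j).
Proof. by rewrite inE; apply: pdecP. Qed.

Lemma segment_cat w i j k p q q' S S' : i <= j -> j <= k ->
  segment w i j p q S -> segment w j k q q' S' -> segment w i k p q' (S :|: S').
Proof.
move=> ij jk [r [rp rq <-]] [r' [r'q r'q' <-]].
exists (fun t => if t <= j then r t else r' t); split.
- by rewrite ij.
- by case: leqP => // kj; rewrite -r'q' (_ : k = j) ?r'q ?rq //; lia.
rewrite (features_cat _ _ ij jk); congr (_ :|: _); apply: eq_features => t /andP[ti tk].
  by rewrite tk.
by case: leqP => // tj; rewrite (_ : t = j) ?rq ?r'q //; lia.
Qed.

Lemma profile_cat w i j k : i <= j -> j <= k ->
  profile w i k = profile_mul (profile w i j) (profile w j k).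
Proof.
move=> ij jk; apply/setP => -[[p q] S]; rewrite !inE; apply/pdecP/existsP => /=.
  move=> [r [<- <- <-]]; exists (r j, features r w i j, features r w j k) => /=.
  rewrite (features_cat r w ij jk) eqxx andbT; apply/andP.
  by split; apply/profileP; exists r.
move=> [[[q' S1] S2] /= /and3P[/profileP s1 /profileP s2 /eqP->]].
exact: segment_cat s1 s2.
Qed.

Lemma profile_shift w w' i i' n : (forall t, t < n -> w (i + t) = w' (i' + t)) ->
  profile w i (i + n) = profile w' i' (i' + n).
Proof.
have sub v v' j j' x : (forall t, t < n -> v (j + t) = v' (j' + t)) ->
    x \in profile v j (j + n) -> x \in profile v' j' (j' + n).
  case: x => [[p q] S] vv' /profileP[r [rp rq rS]]; apply/profileP.
  exists (fun t => r (j + (t - j'))); split.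
  - by rewrite subnn addn0.
  - by rewrite addKn.
  have lab d : d < n -> label (r (j + (j' + d - j'))) (v' (j' + d)) (r (j + ((j' + d).+1 - j'))) =
      label (r (j + d)) (v (j + d)) (r (j + d).+1).
    by move=> dn; rewrite -vv' // addKn -addnS addKn addnS.
  apply/setP => c; rewrite -rS; apply/featuresP/featuresP => -[t /andP[le_t lt_t]].
    rewrite -(subnKC le_t) lab; last lia.
    by exists (j + (t - j')) => //; lia.
  rewrite -(subnKC le_t) -lab; last lia.
  by exists (j' + (t - j)) => //; lia.
by move=> ww'; apply/setP => x; apply/idP/idP; apply: sub => t tn; rewrite ww'.
Qed.

(** A run that follows [s] once and then loops in [e] at [q] forever shows [S0 :|: S1] altogether
    and exactly [S1] infinitely often. *)
Definition pair_accepts (s e : {set M * M * {set C}}) := exists p q S0 S1,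
  [/\ p \in minit M, (p, q, S0) \in s, (q, q, S1) \in e & macc M (S0 :|: S1) S1].

Section Factorization.
Variables (w : nat -> A) (h : nat -> nat).
Hypothesis lth : {homo h : i j / i < j}.

Lemma leq_factor i : i <= h i.
Proof. by elim: i => // i IH; apply: leq_ltn_trans IH (lth _). Qed.

Lemma factor_block t : h 0 <= t -> exists i, h i <= t < h i.+1.
Proof.
move=> t0; have ub i : h i <= t -> i <= t by apply: leq_trans; exact: leq_factor.
have [i hi imax] := ex_maxnP (ex_intro (fun i => h i <= t) 0 t0) ub.
by exists i; rewrite hi ltnNge; apply/negP => /imax; rewrite ltnn.
Qed.

Lemma factor_block_uniq t i j : h i <= t < h i.+1 -> h j <= t < h j.+1 -> i = j.
Proof.
have leh : {homo h : i j / i <= j}.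
  by move=> a b; rewrite leq_eqVlt => /orP[/eqP->//|/lth/ltnW].
by move=> ti tj; case: (ltngtP i j) => // /leh; lia.
Qed.

(** The runs over the blocks all lead from [q] to [q], so they agree at the cuts and glue to one
    run, on which [S1] recurs in every block. *)
Lemma accepts_glue p q S0 S1 : p \in minit M -> segment w 0 (h 0) p q S0 ->
  (forall i, segment w (h i) (h i.+1) q q S1) -> macc M (S0 :|: S1) S1 -> accepts w.
Proof.
move=> pI [r0 [r0p r0q r0S]] /choice_fun[R RP] acc.
have /choice_fun[blk blkP] t : exists i, h 0 <= t -> h i <= t < h i.+1.
  by case: (leqP (h 0) t) => [/factor_block[i ti]|_]; [exists i|exists 0].
pose r t := if t < h 0 then r0 t else R (blk t) t.
have h0 i : h 0 <= h i by case: i => // i; apply: ltnW; apply: lth.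
have r_block i t : h i <= t <= h i.+1 -> r t = R i t.
  case/andP=> it; rewrite /r ltnNge (leq_trans (h0 i) it) /= leq_eqVlt => /orP[/eqP tE|ti].
    have := blkP t (leq_trans (h0 i) it).
    have ti1 : h i.+1 <= t < h i.+2 by rewrite tE leqnn lth.
    move/(factor_block_uniq ti1) <-; rewrite tE.
    by case: (RP i) => _ -> _; case: (RP i.+1).
  by rewrite (@factor_block_uniq t (blk t) i) ?it // blkP // (leq_trans (h0 i)).
have r_init t : t <= h 0 -> r t = r0 t.
  rewrite leq_eqVlt => /orP[/eqP->|th]; last by rewrite /r th.
  by rewrite (r_block 0) ?leqnn ?(ltnW (lth (ltnSn 0))) // r0q; case: (RP 0).
have f0 : features r w 0 (h 0) = S0.
  by rewrite -r0S; apply: eq_features => t /andP[_]; apply: r_init.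
have f1 i : features r w (h i) (h i.+1) = S1.
  by case: (RP i) => _ _ <-; apply: eq_features => t; apply: r_block.
exists r, (S0 :|: S1), S1; split=> // [|c|c].
- by rewrite r_init // r0p.
- split; first by rewrite inE -f0 -(f1 0) => /orP[]/featuresP[t _ ?]; exists t.
  move=> [t ct]; rewrite inE; case: (ltnP t (h 0)) => [t0|/factor_block[i ti]].
    by rewrite -f0; apply/orP; left; apply/featuresP; exists t.
  by rewrite -(f1 i); apply/orP; right; apply/featuresP; exists t.
- split=> [cS i|inf].
    move: cS; rewrite -(f1 i) => /featuresP[t /andP[ht _] ct]; exists t => //.
    exact: leq_trans (leq_factor i) ht.
  have [t /factor_block[i ti] ct] := inf (h 0).
  by rewrite -(f1 i); apply/featuresP; exists t.
Qed.

(** Given an accepting run, let [q] recur at the cuts. Choose a cut at [q] after which only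
    recurring features show, and a later cut at [q] by which all of them have shown again. The run
    between these cuts is a loop with exactly the recurring features, and its profile is [e]. *)
Lemma accepts_factor s e : (forall i, profile w 0 (h i) = s) ->
  (forall i j, i < j -> profile w (h i) (h j) = e) -> accepts w <-> pair_accepts s e.
Proof.
move=> hs he; split; last first.
  move=> [p [q [S0 [S1 [pI ps qe acc]]]]].
  have s0 : segment w 0 (h 0) p q S0 by apply/profileP; rewrite hs.
  apply: accepts_glue pI s0 _ acc => i; apply/profileP.
  by rewrite (he i i.+1).
move=> [r [Sall [Sinf [rI allP infP acc]]]].
have [q qP] := unbounded_color (fun i => r (h i)) (P := fun=> True)
  (fun i => ex_intro2 _ _ i (leqnn i) I).
have [N NP] : exists N, forall c t, N <= t -> c \in label (r t) (w t) (r t.+1) -> c \in Sinf.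
  apply: (@finite_bound _ (fun c N => forall t, N <= t ->
      c \in label (r t) (w t) (r t.+1) -> c \in Sinf)).
    by move=> c m n mn mP t nt; apply: mP; apply: leq_trans _ nt.
  move=> c; apply: NNPP => no_N; have /infP cinf : unbounded
      (fun t => c \in label (r t) (w t) (r t.+1)).
    move=> n; apply: NNPP => no_t; apply: no_N; exists n => t nt ct.
    by case: no_t; exists t.
  by apply: no_N; exists 0.
have [i Ni [_ riq]] := qP N.
have [N' N'P] : exists N', forall c, c \in Sinf -> c \in features r w (h i) N'.
  apply: (@finite_bound _ (fun c N => c \in Sinf -> c \in features r w (h i) N)).
    move=> c m n mn mP /mP/featuresP[t /andP[ht tm] ct]; apply/featuresP.
    by exists t; rewrite ?ht ?(leq_trans tm).
  move=> c; case: (boolP (c \in Sinf)) => [/infP/(_ (h i))[t it ct]|_]; last by exists 0.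
  by exists t.+1 => _; apply/featuresP; exists t; rewrite ?it /=.
have [j N'j [_ rjq]] := qP (maxn i.+1 N').
have lt_ij : i < j by move: N'j; rewrite geq_max => /andP[].
have h_ij := ltnW (lth lt_ij).
have fij : features r w (h i) (h j) = Sinf.
  apply/setP => c; apply/featuresP/idP => [[t /andP[it _]]|/N'P/featuresP[t /andP[it tN]]].
    by apply: NP; apply: leq_trans _ it; apply: leq_trans _ (leq_factor i).
  exists t => //; rewrite it /= (leq_trans tN) // (leq_trans _ (leq_factor j)) //.
  by move: N'j; rewrite geq_max => /andP[].
exists (r 0), q, (features r w 0 (h i)), Sinf; split=> //.
- by rewrite -(hs i); apply/profileP; exists r.
- by rewrite -(he i j lt_ij); apply/profileP; exists r.
rewrite (_ : _ :|: _ = Sall) //; apply/setP => c; rewrite -fij -features_cat //.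
apply/featuresP/idP => [[t _ ct]|/allP[t ct]]; first by apply/allP; exists t.
case: (ltnP t (h j)) => [tj|jt]; first by exists t.
have : c \in Sinf.
  apply: NP ct; apply: leq_trans _ jt; apply: leq_trans _ h_ij.
  exact: leq_trans _ (leq_factor i).
by rewrite -fij => /featuresP[t' /andP[_ ?] ?]; exists t'.
Qed.
End Factorization.

(** The finite counterpart of acceptance: the part of the run from [i] to [j] is a loop meant to be
    repeated forever. *)
Definition one_loop w i j := exists r, [/\ r 0 \in minit M, r i = r j &
  macc M (features r w 0 j) (features r w i j)].

Lemma one_loopP w i j : i <= j ->
  one_loop w i j <-> pair_accepts (profile w 0 i) (profile w i j).
Proof.
move=> ij; split=> [[r [rI rij]]|[p [q [S0 [S1 [pI /profileP s0 /profileP s1 acc]]]]]].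
  rewrite (features_cat _ _ (leq0n i) ij) => acc.
  exists (r 0), (r i), (features r w 0 i), (features r w i j); split=> //.
    by apply/profileP; exists r.
  by apply/profileP; exists r.
move: s0 s1 => [r [rp rq rS]] [r' [r'q r'q' r'S]].
exists (fun t => if t <= i then r t else r' t); split=> /=.
- by rewrite rp.
- by rewrite leqnn rq; case: leqP => // ji; rewrite -rq; congr r; lia.
have f1 : features (fun t => if t <= i then r t else r' t) w i j = S1.
  rewrite -r'S; apply: eq_features => t /andP[it tj].
  by case: leqP => // ti; rewrite (_ : t = i) ?rq ?r'q //; lia.
rewrite (features_cat _ _ (leq0n i) ij) f1 (_ : features _ _ _ _ = S0) //.
by rewrite -rS; apply: eq_features => t /andP[_ ->].
Qed.

Definition periodic w m k := forall t, m <= t -> w (t + k) = w t.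

Lemma profile_periodic w m k i n : periodic w m k ->
  profile w (m + i * k) (m + i * k + n) = profile w m (m + n).
Proof.
move=> per; apply: profile_shift => t _; elim: i => [|i IH]; first by rewrite addn0.
by rewrite mulSn addnCA -addnA addnC per ?IH //; lia.
Qed.

Lemma periodic_mul w m k l : periodic w m k -> periodic w m (l * k).
Proof.
move=> per t mt; elim: l => [|l IH]; first by rewrite addn0.
by rewrite mulSn addnCA addnC per ?IH //; lia.
Qed.

Lemma periodic_accepts w m k e : 0 < k -> periodic w m k ->
  profile w m (m + k) = e -> profile_mul e e = e ->
  accepts w <-> pair_accepts (profile_mul (profile w 0 m) e) e.
Proof.
move=> k0 per we ee.
have wpow d : profile w m (m + d.+1 * k) = e.
  elim: d => [|d IH]; first by rewrite mul1n.
  rewrite (_ : m + d.+2 * k = m + d.+1 * k + k); last lia.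
  by rewrite (@profile_cat w m (m + d.+1 * k)) ?IH ?profile_periodic ?we //; lia.
(* The first cut is [m + k]: the prefix up to [m] may have another profile than the prefixes up to
   later cuts, which all absorb a factor [e]. *)
apply: (@accepts_factor w (fun i => m + i.+1 * k)).
- by move=> i j ij; rewrite ltn_add2l ltn_pmul2r.
- by move=> i; rewrite (@profile_cat w 0 m) ?wpow //; lia.
move=> i j ij; have -> : j.+1 = i.+1 + (j - i.+1).+1 by lia.
by rewrite mulnDl addnA profile_periodic.
Qed.

(* The profile of the period need not be idempotent, but that of some power is, and then one loop
   suffices. *)
Lemma lasso_accepts w m k B : 0 < k -> periodic w m k -> #|{set M * M * {set C}}| <= B ->
  accepts w <-> exists l, [/\ 0 < l, l <= B & one_loop w (m + l * k) (m + l * k + l * k)].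
Proof.
move=> k0 per leB; split=> [acc|[l [l0 lB [r [rI rl acc]]]]].
  have powD i j : 0 < i -> 0 < j -> profile w m (m + (i + j) * k) =
      profile_mul (profile w m (m + i * k)) (profile w m (m + j * k)).
    by move=> _ _; rewrite (@profile_cat w m (m + i * k)) ?mulnDl ?addnA ?profile_periodic //; lia.
  have [l [l0 lT idem]] := idempotent_power powD.
  exists l; split=> //; first exact: leq_trans _ leB.
  have lk0 : 0 < l * k by rewrite muln_gt0 l0.
  move/(periodic_accepts lk0 (periodic_mul l per) erefl idem): acc.
  rewrite one_loopP; last lia.
  by rewrite (@profile_cat w 0 m (m + l * k)) ?profile_periodic //; lia.
(* Conversely, the block read by the loop recurs forever by periodicity, so the loop can be repeated
   on it. *)
have per_l i : profile w (m + i.+1 * (l * k)) (m + i.+1 * (l * k) + l * k) =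
    profile w m (m + l * k) by apply: profile_periodic; exact: periodic_mul.
have seg i : segment w (m + i.+1 * (l * k)) (m + i.+2 * (l * k)) (r (m + l * k)) (r (m + l * k))
    (features r w (m + l * k) (m + l * k + l * k)).
  apply/profileP; rewrite (_ : m + i.+2 * (l * k) = m + i.+1 * (l * k) + l * k); last lia.
  by rewrite per_l -(per_l 0) mul1n; apply/profileP; exists r.
apply: (@accepts_glue w (fun i => m + i.+1 * (l * k)) _ _ _ _ _ rI _ seg).
- by move=> i j ij; rewrite ltn_add2l ltn_pmul2r // muln_gt0 l0.
- by rewrite mul1n; exists r.
by rewrite -features_cat //; lia.
Qed.

End Muller.

(** * Short words, lassos and equivalence of Muller automata *)

(** In a longer word two nonempty prefixes have the same value; cutting out what lies between them
    keeps the value of the whole word and leaves it nonempty. *)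
Lemma short_word (A T : finType) (mul : T -> T -> T) (P : (nat -> A) -> nat -> T) :
  (forall f i n, P f (i + n) = mul (P f i) (P (fun t => f (i + t)) n)) ->
  (forall f g n, (forall t, t < n -> f t = g t) -> P f n = P g n) ->
  forall f n, 0 < n -> exists g m, [/\ 0 < m, m <= #|T| & P g m = P f n].
Proof.
move=> PD Pext f n; elim/ltn_ind: n f => n IH f n0.
case: (leqP n #|T|) => [le_n|lt_n]; first by exists f, n.
have [i [j [/andP[i0 ij] jT eq_ij]]] := pigeonhole (P f) 1.
have jn : j <= n := leq_trans jT lt_n.
pose g t := if t < i then f t else f (t + (j - i)).
have [|//|g' [m [m0 mT gm]]] := IH (i + (n - j)) _ g; [lia..|].
exists g', m; split=> //; rewrite gm PD -[in RHS](subnKC jn) PD -eq_ij; congr mul.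
  by apply: Pext => t ti; rewrite /g ti.
by apply: Pext => t _; rewrite /g ltnNge leq_addr /=; congr f; lia.
Qed.

Definition lasso (A : Type) (u : nat -> A) m (v : nat -> A) k t :=
  if t < m then u t else v ((t - m) %% k).

Lemma lasso_periodic (A : finType) (u v : nat -> A) m k : periodic (lasso u m v k) m k.
Proof.
move=> t mt; rewrite /lasso !ltnNge mt (leq_trans mt (leq_addr _ _)) /=.
by rewrite -addnBAC // modnDr.
Qed.

Lemma profile_lasso_head (A C : finType) (M : muller A C) u m v k :
  profile M (lasso u m v k) 0 m = profile M u 0 m.
Proof. by apply: (@profile_shift _ _ _ _ _ 0 0) => t tm; rewrite /lasso tm. Qed.

Lemma profile_lasso_loop (A C : finType) (M : muller A C) u m v k :
  profile M (lasso u m v k) m (m + k) = profile M v 0 k.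
Proof.
apply: (@profile_shift _ _ _ _ _ m 0) => t tk.
by rewrite /lasso ltnNge leq_addr /= addKn modn_small.
Qed.

Definition lasso_accepted (A C : finType) (M : muller A C) w m k B :=
  exists l, [/\ 0 < l, l <= B & one_loop M w (m + l * k) (m + l * k + l * k)].

Section Equivalence.
Variables (A C : finType) (M1 M2 : muller A C) (B : nat).
Let T := ({set M1 * M1 * {set C}} * {set M2 * M2 * {set C}})%type.
Hypothesis leB : #|{: T}| <= B.

Lemma card_profile1 : #|{set M1 * M1 * {set C}}| <= B.
Proof.
by apply: leq_trans leB; rewrite card_prod leq_pmulr //; apply/card_gt0P; exists set0.
Qed.

Lemma card_profile2 : #|{set M2 * M2 * {set C}}| <= B.
Proof.
by apply: leq_trans leB; rewrite card_prod leq_pmull //; apply/card_gt0P; exists set0.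
Qed.

Let mul (x y : T) : T := (profile_mul x.1 y.1, profile_mul x.2 y.2).

Lemma short_profile (f : nat -> A) i n : 0 < n -> exists g m, [/\ 0 < m, m <= B,
  profile M1 g 0 m = profile M1 f i (i + n) & profile M2 g 0 m = profile M2 f i (i + n)].
Proof.
move=> n0; pose P f n : T := (profile M1 f 0 n, profile M2 f 0 n).
have PD f' j d : P f' (j + d) = mul (P f' j) (P (fun t => f' (j + t)) d).
  rewrite /P /mul /= (profile_cat M1 f' (leq0n j) (leq_addr d j)).
  rewrite (profile_cat M2 f' (leq0n j) (leq_addr d j)).
  rewrite -(@profile_shift _ _ M1 (fun t => f' (j + t)) f' 0 j d) //.
  by rewrite -(@profile_shift _ _ M2 (fun t => f' (j + t)) f' 0 j d).
have Pext f' g d : (forall t, t < d -> f' t = g t) -> P f' d = P g d.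
  by move=> fg; congr (_, _); apply: (@profile_shift _ _ _ _ _ 0 0 d).
have [g [m [m0 mT [g1 g2]]]] := short_word PD Pext (fun t => f (i + t)) n0.
exists g, m; split=> //; first exact: leq_trans mT leB.
  by rewrite g1; apply: (@profile_shift _ _ _ _ _ 0 i n).
by rewrite g2; apply: (@profile_shift _ _ _ _ _ 0 i n).
Qed.

(** Colouring by the profiles in both automata at once yields one factorization of [w], and one pair
    of short words, that serve both. Consecutive cuts show [e e = e] and [s e = s], so in each
    automaton [w] and the lasso are accepted under the same condition [pair_accepts s e]. *)
Lemma accepts_equiv :
  (forall w, accepts M1 w <-> accepts M2 w) <->
  (forall u m v k, m <= B -> 0 < k -> k <= B ->
     lasso_accepted M1 (lasso u m v k) m k B <-> lasso_accepted M2 (lasso u m v k) m k B).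
Proof.
split=> [eqM u m v k mB k0 kB|eqM w].
  have per := @lasso_periodic A u v m k.
  have acc1 := lasso_accepts k0 per card_profile1.
  have acc2 := lasso_accepts k0 per card_profile2.
  by have := eqM (lasso u m v k); rewrite /lasso_accepted; tauto.
have [h [[s1 s2] [[e1 e2] [h0 lth hs he]]]] := @additive_ramsey T mul
  (fun i j => (profile M1 w i j, profile M2 w i j))
  (fun i j k ij jk => congr2 pair (profile_cat M1 w (ltnW ij) (ltnW jk))
                                  (profile_cat M2 w (ltnW ij) (ltnW jk))).
have h01 : h 0 < h 1 by apply: lth.
have h12 : h 1 < h 2 by apply: lth.
have hs1 i : profile M1 w 0 (h i) = s1 by case: (hs i).
have hs2 i : profile M2 w 0 (h i) = s2 by case: (hs i).
have he1 i j : i < j -> profile M1 w (h i) (h j) = e1 by case/he.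
have he2 i j : i < j -> profile M2 w (h i) (h j) = e2 by case/he.
have ee1 : profile_mul e1 e1 = e1.
  by rewrite -{1}(he1 0 1) // -{1}(he1 1 2) // -profile_cat ?he1 // ltnW.
have ee2 : profile_mul e2 e2 = e2.
  by rewrite -{1}(he2 0 1) // -{1}(he2 1 2) // -profile_cat ?he2 // ltnW.
have se1 : profile_mul s1 e1 = s1.
  by rewrite -{1}(hs1 0) -{1}(he1 0 1) // -profile_cat ?hs1 // ltnW.
have se2 : profile_mul s2 e2 = s2.
  by rewrite -{1}(hs2 0) -{1}(he2 0 1) // -profile_cat ?hs2 // ltnW.
have [u [m [_ mB]]] := short_profile w 0 h0; rewrite add0n hs1 hs2 => us1 us2.
have h10 : 0 < h 1 - h 0 by rewrite subn_gt0.
have [v [k [k0 kB]]] := short_profile w (h 0) h10.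
rewrite subnKC ?(ltnW h01) // he1 // he2 // => ve1 ve2.
have per := @lasso_periodic A u v m k.
have acc1 := lasso_accepts k0 per card_profile1.
have acc2 := lasso_accepts k0 per card_profile2.
have := periodic_accepts (M := M1) k0 per; rewrite profile_lasso_loop profile_lasso_head us1 ve1.
move=> /(_ e1 erefl ee1); rewrite se1 => pair1.
have := periodic_accepts (M := M2) k0 per; rewrite profile_lasso_loop profile_lasso_head us2 ve2.
move=> /(_ e2 erefl ee2); rewrite se2 => pair2.
have := accepts_factor lth hs1 he1; have := accepts_factor lth hs2 he2.
by have := eqM u m v k mB k0 kB; rewrite /lasso_accepted; tauto.
Qed.
End Equivalence.

(** * Behaviors as Muller conditions *)

Lemma qle_refl x : qle x x. Proof. by case: x => //= r; exact: Order.POrderTheory.lexx. Qed.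

Lemma qle_trans y x z : qle x y -> qle y z -> qle x z.
Proof. by case: x y z => [|r|] [|s|] [|t|] //=; apply: Order.POrderTheory.le_trans. Qed.

Lemma qle_anti x y : qle x y -> qle y x -> x = y.
Proof.
case: x y => [|r|] [|s|] //= rs sr; congr QFin; apply: Order.POrderTheory.le_anti.
by rewrite rs.
Qed.

Lemma qle_total x y : qle x y || qle y x.
Proof. by case: x y => [|r|] [|s|] //=; apply: Order.TotalTheory.le_total. Qed.

(** Since [qsup] is a choice, a supremum must first be exhibited. Induction on the list finds it as
    a maximum, or as -oo for the empty set. *)
Lemma qsup_finite (l : seq qbar) S : (forall x, S x -> x \in l) ->
  is_sup S (qsup S) /\ (S (qsup S) \/ qsup S = QNinf /\ forall x, ~ S x).
Proof.
suff : (forall x, S x -> x \in l) ->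
    exists s, is_sup S s /\ (S s \/ s = QNinf /\ forall x, ~ S x).
  move=> ex /ex[s [sS sP]]; have := epsilon_spec (inhabits QNinf) (is_sup S) (ex_intro _ _ sS).
  rewrite -/(qsup S) => qS; suff -> : qsup S = s by [].
  by apply: qle_anti; [apply: qS.2; exact: sS.1|apply: sS.2; exact: qS.1].
elim: l S => [|a l IH] S Sl.
  by exists QNinf; split; [split=> // x /Sl|right; split=> // x /Sl].
have [x [Sx xa]|s [[sub lub] sP]] := IH (fun x => S x /\ x <> a).
  by have := Sl x Sx; rewrite inE => /orP[/eqP/xa|].
case: (classic (S a)) => [Sa|nSa]; last first.
  have SS x : S x <-> S x /\ x <> a by split=> [Sx|[]] //; split=> // xa; rewrite xa in Sx.
  exists s; split; first by split=> [x /SS|u uP]; [apply: sub|apply: lub => x /SS/uP].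
  by case: sP => [[]|[-> no]]; [left|right; split=> // x /SS/no].
case: (boolP (qle s a)) => [sa|nsa].
  exists a; split; last by left.
  split=> [x Sx|u]; last by apply.
  by case: (classic (x = a)) => [->|xa]; [exact: qle_refl|apply: qle_trans sa; apply: sub].
have as_ : qle a s by have := qle_total a s; rewrite (negbTE nsa) orbF.
exists s; split; last by case: sP => [[? _]|[sN _]]; [left|rewrite sN in nsa].
split=> [x Sx|u uP]; last by apply: lub => x [/uP].
by case: (classic (x = a)) => [->//|xa]; apply: sub.
Qed.

Lemma qinf_finite (l : seq qbar) S : (forall x, S x -> x \in l) ->
  is_inf S (qinf S) /\ (S (qinf S) \/ qinf S = QInf /\ forall x, ~ S x).
Proof.
suff : (forall x, S x -> x \in l) ->
    exists s, is_inf S s /\ (S s \/ s = QInf /\ forall x, ~ S x).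
  move=> ex /ex[s [sS sP]]; have := epsilon_spec (inhabits QNinf) (is_inf S) (ex_intro _ _ sS).
  rewrite -/(qinf S) => qS; suff -> : qinf S = s by [].
  by apply: qle_anti; [apply: sS.2; exact: qS.1|apply: qS.2; exact: sS.1].
elim: l S => [|a l IH] S Sl.
  exists QInf; split; last by right; split=> // x /Sl.
  by split=> [x /Sl //|u _]; case: u.
have [x [Sx xa]|s [[slb glb] sP]] := IH (fun x => S x /\ x <> a).
  by have := Sl x Sx; rewrite inE => /orP[/eqP/xa|].
case: (classic (S a)) => [Sa|nSa]; last first.
  have SS x : S x <-> S x /\ x <> a by split=> [Sx|[]] //; split=> // xa; rewrite xa in Sx.
  exists s; split; first by split=> [x /SS|u uP]; [apply: slb|apply: glb => x /SS/uP].
  by case: sP => [[]|[-> no]]; [left|right; split=> // x /SS/no].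
case: (boolP (qle a s)) => [sa|nsa].
  exists a; split; last by left.
  split=> [x Sx|u]; last by apply.
  by case: (classic (x = a)) => [->|xa]; [exact: qle_refl|apply: qle_trans sa _; apply: slb].
have as_ : qle s a by have := qle_total s a; rewrite (negbTE nsa) orbF.
exists s; split; last by case: sP => [[? _]|[sN _]]; [left|rewrite sN in nsa; case: (a) nsa].
split=> [x Sx|u uP]; last by apply: glb => x [/uP].
by case: (classic (x = a)) => [->//|xa]; apply: slb.
Qed.

Section FiniteSet.
Variables (l : seq qbar) (S : qbar -> Prop).
Hypothesis Sl : forall x, S x -> x \in l.

(** The supremum is attained unless [S] is empty; it is then -oo, whence the condition on [x]. *)
Lemma le_qsup x : x <> QNinf -> qle x (qsup S) <-> exists s, S s /\ qle x s.
Proof.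
move=> xN; have [[ub _] at_] := qsup_finite Sl; split=> [xs|[s [/ub ss xs]]].
  case: at_ => [Ss|[sN _]]; first by exists (qsup S).
  by move: xs xN; rewrite sN; case: x.
exact: qle_trans xs ss.
Qed.

Lemma le_qinf x : qle x (qinf S) <-> forall s, S s -> qle x s.
Proof.
have [[lb glb] _] := qinf_finite Sl; split=> [xs s /lb|]; [exact: qle_trans|exact: glb].
Qed.

Lemma qsup_mem : qsup S \in QNinf :: l.
Proof. by rewrite inE; case: (qsup_finite Sl) => _ [/Sl ->|[-> _]]; rewrite ?orbT. Qed.

Lemma qinf_mem : qinf S \in QInf :: l.
Proof. by rewrite inE; case: (qinf_finite Sl) => _ [/Sl ->|[-> _]]; rewrite ?orbT. Qed.
End FiniteSet.

(* The arguments tell whether, along a run, the weight -oo occurs, whether finite weights at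
   least (resp. below) the threshold occur, whether they occur infinitely often, and whether
   final states do. *)
Definition acceptance K (ninf ge lt ge_often lt_often final_often : bool) :=
  [&& final_often, ~~ ninf & match K with
  | K1 => ~~ lt_often && (ge_often || ~~ lt)
  | K2 => [|| ge_often, ~~ ge && ~~ lt | ~~ lt_often && ge]
  | K3 => ge || ~~ lt
  end].

Section Valuation.
Variables (l : seq qbar) (d : nat -> qbar).
Hypothesis dl : forall i, d i \in l.

Definition finite_tail i y := exists k, (i <= k)%N /\ d k <> QInf /\ y = d k.

Definition finite_range y := exists k, d k <> QInf /\ y = d k.

Lemma tail_mem i y : finite_tail i y -> y \in l.
Proof. by case=> k [_ [_ ->]]. Qed.

Lemma range_mem y : finite_range y -> y \in l.
Proof. by case=> k [_ ->]. Qed.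

Lemma tail_inf_mem x : (exists i, x = qinf (finite_tail i)) ->
  x \in QInf :: l.
Proof. by case=> i ->; apply: qinf_mem => y; apply: tail_mem. Qed.

Lemma tail_sup_mem x : (exists i, x = qsup (finite_tail i)) ->
  x \in QNinf :: l.
Proof. by case=> i ->; apply: qsup_mem => y; apply: tail_mem. Qed.

(** Consequently a behavior has finitely many possible values, and finitely many thresholds suffice
    to determine it. *)
Lemma omega_val_mem K : omega_val K d \in [:: QNinf, QInf & l].
Proof.
have sub1 y : y \in QNinf :: l -> y \in [:: QNinf, QInf & l].
  by rewrite !inE => /orP[->//|->]; rewrite !orbT.
have sub2 y : y \in QInf :: l -> y \in [:: QNinf, QInf & l] by rewrite !inE => ->; rewrite orbT.
case: K; rewrite /= /val_liminf /val_limsup /val_supninf; case: pdecP => _ //;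
  case: pdecP => _; rewrite ?inE ?eqxx ?orbT // -!in_cons.
- case: pdecP => _; first exact: qsup_mem tail_inf_mem.
  by apply/sub2/qinf_mem/range_mem.
- case: pdecP => _; last by apply/sub1/qsup_mem/range_mem.
  have := qinf_mem tail_sup_mem; rewrite !inE => /or3P[] -> //; rewrite ?orbT //.
by apply/sub1/qsup_mem/range_mem.
Qed.

Variable x : qbar.
Hypothesis xN : x <> QNinf.
Let ge y := (y != QInf) && qle x y.
Let lt y := (y != QInf) && ~~ qle x y.

(** The features tell which case of the valuation applies: without -oo, all entries are +oo iff [h0]
    and [l0] fail, and infinitely many differ from +oo iff [h1] or [l1] holds. The suprema and
    infima involved range over finite sets, so comparing them with [x] reduces to comparing
    entries. *)
Lemma omega_val_ge K (ninf h0 l0 h1 l1 : bool) :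
  (ninf <-> exists t, d t == QNinf) ->
  (h0 <-> exists t, ge (d t)) -> (l0 <-> exists t, lt (d t)) ->
  (h1 <-> unbounded (fun t => ge (d t))) -> (l1 <-> unbounded (fun t => lt (d t))) ->
  qle x (omega_val K d) <-> acceptance K ninf h0 l0 h1 l1 true.
Proof.
move=> ninfP h0P l0P h1P l1P.
have ge_lt t : d t <> QInf -> ge (d t) || lt (d t).
  by move=> /eqP dt; rewrite /ge /lt dt; case: qle.
have lt_ge t : d t <> QInf -> ~~ lt (d t) -> qle x (d t).
  by move=> /eqP dt; rewrite /lt dt negbK.
have often : inf_often_fin d -> ~~ l1 -> h1.
  move=> inf /negP nl1; apply/h1P => i; apply: NNPP => no_j; apply/nl1/l1P => i'.
  have [k [ik dk]] := inf (maxn i i'); exists k; first lia.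
  case/orP: (ge_lt k dk) => // gek; case: no_j; exists k => //; lia.
have fin_h : ~ inf_often_fin d -> h1 = false.
  move=> nf; apply/negP => /h1P inf; apply: nf => i.
  by have [j ij /andP[/eqP dj _]] := inf i; exists j.
have fin_l : ~ inf_often_fin d -> l1 = false.
  move=> nf; apply/negP => /l1P inf; apply: nf => i.
  by have [j ij /andP[/eqP dj _]] := inf i; exists j.
have h10 : h1 -> h0 by move/h1P/(_ 0) => [j _ gj]; apply/h0P; exists j.
have l10 : l1 -> l0 by move/l1P/(_ 0) => [j _ gj]; apply/l0P; exists j.
have valN : (omega_val K d = QNinf /\ ninf) \/ (omega_val K d = QInf /\ [&& ~~ ninf, ~~ h0 & ~~ l0])
    \/ (~~ ninf /\ (h0 || l0) /\ omega_val K d = 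
      match K with
      | K1 => if pdec (inf_often_fin d) then
            qsup (fun x => exists i, x = qinf (finite_tail i))
          else qinf finite_range
      | K2 => if pdec (inf_often_fin d) then
            qinf (fun x => exists i, x = qsup (finite_tail i))
          else qsup finite_range
      | K3 => qsup finite_range
      end).
  have [[i di]|nN] := classic (some_ninf d).
    left; split; last by apply/ninfP; exists i; apply/eqP.
    by case: (K); rewrite /= /val_liminf /val_limsup /val_supninf;
      (case: pdecP; last by case; exists i).
  have ninfF : ~~ ninf by apply/negP => /ninfP[i /eqP di]; apply: nN; exists i.
  right; have [aI|nI] := classic (all_inf d).
    left; split.
      by case: (K); rewrite /= /val_liminf /val_limsup /val_supninf;
        (case: pdecP => // _; case: pdecP).
    rewrite ninfF /=; apply/andP; split; apply/negP.
      by move/h0P => [t /andP[/eqP]]; rewrite aI.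
    by move/l0P => [t /andP[/eqP]]; rewrite aI.
  right; split=> //; split.
    have [i di] : exists i, d i <> QInf.
      by apply: NNPP => no; apply: nI => i; apply: NNPP => di; apply: no; exists i.
    by case/orP: (ge_lt i di) => gl; apply/orP; [left; apply/h0P|right; apply/l0P]; exists i.
  by case: (K); rewrite /= /val_liminf /val_limsup /val_supninf;
    (case: pdecP => // _; case: pdecP).
case: valN => [[-> ninfT]|[[-> /and3P[nN nh nl]]|[nN [hl ->]]]]; rewrite /acceptance /=.
- by rewrite ninfT; case: (x) xN.
- have nh1 : ~~ h1 by apply: contra nh.
  have nl1 : ~~ l1 by apply: contra nl.
  by rewrite nN nh nl nl1 ?orbT; split=> _; [case: (K)|case: (x)]; rewrite ?orbT.
rewrite nN /=; case: (K).
- case: pdecP => inf; last first.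
    rewrite fin_h // fin_l //= (le_qinf range_mem); split=> [all_ge|/negP nl0 s [i [di ->]]].
      by apply/negP => /l0P[t /andP[/eqP dt /negP]]; apply; apply: all_ge; exists t.
    by apply: lt_ge => //; apply/negP => li; apply/nl0/l0P; exists i.
  have -> : ~~ l1 && (h1 || ~~ l0) = ~~ l1.
    by case: (boolP l1) => //= nl1; rewrite often.
  rewrite (le_qsup tail_inf_mem xN); split=> [[_ [[i ->]]]|/negP nl1].
    rewrite (le_qinf (@tail_mem i)) => all_ge; apply/negP => /l1P/(_ i)[j ij /andP[/eqP dj /negP]].
    by apply; apply: all_ge; exists j.
  have [i iP] : exists i, forall j, i <= j -> ~~ lt (d j).
    apply: NNPP => no_i; apply/nl1/l1P => i; apply: NNPP => no_j; apply: no_i.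
    by exists i => j ij; apply/negP => lj; apply: no_j; exists j.
  exists (qinf (finite_tail i)); split; first by exists i.
  by apply/(le_qinf (@tail_mem i)) => s [k [ik [dk ->]]]; apply: lt_ge => //; apply: iP.
- case: pdecP => inf; last first.
    rewrite fin_h // fin_l //= (le_qsup range_mem xN).
    have -> : ~~ h0 && ~~ l0 || h0 = h0 by move: hl; case: (h0); case: (l0).
    split=> [[_ [[i [di ->]] xi]]|/h0P[t /andP[/eqP dt xt]]].
      by apply/h0P; exists i; apply/andP; split=> //; apply/eqP.
    by exists (d t); split=> //; exists t.
  have -> : [|| h1, ~~ h0 && ~~ l0 | ~~ l1 && h0] = h1.
    rewrite -negb_or hl /=; case: (boolP h1) => // nh1.
    by case: (boolP l1) => //= nl1; move: nh1; rewrite often.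
  rewrite (le_qinf tail_sup_mem); split=> [all_ge|/h1P h1i _ [i ->]].
    apply/h1P => i; have /(le_qsup (@tail_mem i) xN)[_ [[k [ik [dk ->]]] xk]] :=
      all_ge _ (ex_intro _ i erefl).
    by exists k => //; apply/andP; split=> //; apply/eqP.
  apply/(le_qsup (@tail_mem i) xN); have [j ij /andP[/eqP dj xj]] := h1i i.
  by exists (d j); split=> //; exists j.
rewrite (le_qsup range_mem xN).
have -> : h0 || ~~ l0 = h0 by move: hl; case: (h0); case: (l0).
split=> [[_ [[i [di ->]] xi]]|/h0P[t /andP[/eqP dt xt]]].
  by apply/h0P; exists i; apply/andP; split=> //; apply/eqP.
by exists (d t); split=> //; exists t.
Qed.
End Valuation.

Section Behavior.
Variables (A : finType) (K : kind) (N : wba A).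

Definition weights : seq qbar := [seq wba_wt N y | y <- enum {: 'I_(projT1 N) * A * 'I_(projT1 N)}].

Lemma weights_mem y : wba_wt N y \in weights.
Proof. by apply: map_f; rewrite mem_enum. Qed.

Lemma path_weight_mem w (x : qbar) :
  (exists q : nat -> 'I_(projT1 N), @successful A N q /\ x = @path_weight A K N w q) ->
  x \in [:: QNinf, QInf & weights].
Proof. by case=> q [_ ->]; apply: omega_val_mem => i; apply: weights_mem. Qed.

Lemma behavior_mem w : behavior K N w \in [:: QNinf, QInf & weights].
Proof.
have := qsup_mem (@path_weight_mem w); rewrite -/(behavior K N w) !inE.
by case/or4P=> ->; rewrite ?orbT.
Qed.

(** A weight -oo shows bit 0 and also bit 2, as it lies below every threshold other than -oo. *)
Definition feature_bits x y final :=
  [:: y == QNinf; (y != QInf) && qle x y; (y != QInf) && ~~ qle x y; final].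

Definition threshold_label x (p : 'I_(projT1 N)) (a : A) (q : 'I_(projT1 N)) : {set 'I_4} :=
  [set c : 'I_4 | nth false (feature_bits x (wba_wt N (p, a, q)) (p \in wba_fin N)) c].

Definition feature (i : nat) : 'I_4 := inord i.

Definition threshold_muller x : muller A 'I_4 := Muller (@threshold_label x) (wba_init N)
  (fun S0 S1 => acceptance K (feature 0 \in S0) (feature 1 \in S0) (feature 2 \in S0)
     (feature 1 \in S1) (feature 2 \in S1) (feature 3 \in S1)).

Lemma threshold_accepts x w : x <> QNinf ->
  accepts (threshold_muller x) w <-> qle x (behavior K N w).
Proof.
move=> xN; rewrite /behavior (le_qsup (@path_weight_mem w) xN).
pose bit (r : nat -> 'I_(projT1 N)) t i :=
  nth false (feature_bits x (wba_wt N (r t, w t, r t.+1)) (r t \in wba_fin N)) i.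
have labE r t i : i < 4 -> (feature i \in threshold_label x (r t) (w t) (r t.+1)) = bit r t i.
  by move=> i4; rewrite inE inordK.
have core (r : nat -> 'I_(projT1 N)) (S0 S1 : {set 'I_4}) :
    (forall c, c \in S0 <-> exists t, c \in threshold_label x (r t) (w t) (r t.+1)) ->
    (forall c, c \in S1 <-> unbounded (fun t => c \in threshold_label x (r t) (w t) (r t.+1))) ->
    macc (threshold_muller x) S0 S1 <->
    (qle x (path_weight K w r) /\ unbounded (fun t => r t \in wba_fin N)).
  move=> S0P S1P.
  have ex i : i < 4 -> feature i \in S0 <-> exists t, bit r t i.
    by move=> i4; rewrite S0P; split=> -[t ct]; exists t; move: ct; rewrite labE.
  have unb i : i < 4 -> feature i \in S1 <-> unbounded (fun t => bit r t i).
    move=> i4; rewrite S1P; split=> inf j; have [t jt ct] := inf j; exists t => //; move: ct.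
      by rewrite labE.
    by rewrite labE.
  (* The bit for final states is split off, because [omega_val_ge] concerns the weights alone. *)
  have -> : macc (threshold_muller x) S0 S1 = acceptance K (feature 0 \in S0) (feature 1 \in S0)
    (feature 2 \in S0) (feature 1 \in S1) (feature 2 \in S1) true && (feature 3 \in S1).
    by rewrite /= /acceptance /= andbC.
  have := @omega_val_ge weights (fun j => wba_wt N (r j, w j, r j.+1))
    (fun i => weights_mem _) x xN K _ _ _ _ _ (ex 0 isT) (ex 1 isT) (ex 2 isT)
    (unb 1 isT) (unb 2 isT).
  rewrite -/(path_weight K w r) => valP; have finP := unb 3 isT; split.
    by case/andP=> /valP ? /finP.
  by case=> /valP-> /finP.
split=> [[r [S0 [S1 [rI S0P S1P /(core r S0 S1 S0P S1P)[xr fin]]]]]|].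
  exists (path_weight K w r); split=> //; exists r; split=> //; split=> //.
  (* Infinitely many visits to final states include infinitely many to a single one. *)
  have [f fP] := unbounded_color r fin.
  have [j _ [jF jf]] := fP 0; exists f; rewrite -{1}jf jF; split=> // i.
  by have [k ik [_ kf]] := fP i; exists k.
move=> [_ [[r [[rI [f [fF fP]]] ->]] xr]].
pose lab t := threshold_label x (r t) (w t) (r t.+1).
exists r, [set c | pdec (exists t, c \in lab t)], [set c | pdec (unbounded (fun t => c \in lab t))].
split=> // [c|c|]; first by rewrite inE; exact: iff_sym (rwP (pdecP _)).
  by rewrite inE; exact: iff_sym (rwP (pdecP _)).
apply/core => [c|c|]; first by rewrite inE; exact: iff_sym (rwP (pdecP _)).
  by rewrite inE; exact: iff_sym (rwP (pdecP _)).
by split=> // i; have [j [ij jf]] := fP i; exists j; rewrite ?jf.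
Qed.
End Behavior.

(** Each of the two values is -oo or itself one of the thresholds; testing at it gives one of the
    two inequalities. *)
Lemma behavior_eq (A : finType) K (N N' : wba A) w :
  behavior K N w = behavior K N' w <->
  (forall x, x \in QInf :: weights N ++ weights N' -> x <> QNinf ->
     qle x (behavior K N w) <-> qle x (behavior K N' w)).
Proof.
split=> [-> //|eqx]; apply: qle_anti.
  have := behavior_mem K N w; rewrite inE => /orP[/eqP-> //|mem].
  case: (classic (behavior K N w = QNinf)) => [-> //|bN].
  apply/(eqx _ _ bN); last exact: qle_refl.
  by move: mem; rewrite !inE mem_cat => /orP[->|->]; rewrite ?orbT.
have := behavior_mem K N' w; rewrite inE => /orP[/eqP-> //|mem].
case: (classic (behavior K N' w = QNinf)) => [-> //|bN].
apply/(eqx _ _ bN); last exact: qle_refl.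
by move: mem; rewrite !inE mem_cat => /orP[->|->]; rewrite ?orbT.
Qed.

(** * The decision formula *)

Ltac quantifier_step :=
  lazymatch goal with
  | |- computableb _ (fun v => has _ (iota 0 _)) => apply: computableb_has; cbv beta
  | |- computableb _ (fun v => all _ (iota 0 _)) => apply: computableb_all; cbv beta
  end.

Section Formula.
Variables (a : nat) (K : kind).

Definition letter_code u m v k t := if t < m then dig a u t else dig a v ((t - m) %% k).

Definition step_code c u m v k r t :=
  weight_code a c (dig (states c) r t) (letter_code u m v k t) (dig (states c) r t.+1).

Definition run_accepted_code c x u m v k i j r :=
  [&& is_init c (dig (states c) r 0), dig (states c) r i == dig (states c) r j &
   acceptance K
     (has (fun t => step_code c u m v k r t == 0) (iota 0 j))
     (has (fun t => (step_code c u m v k r t != 1) && qle_code x (step_code c u m v k r t))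
        (iota 0 j))
     (has (fun t => (step_code c u m v k r t != 1) && ~~ qle_code x (step_code c u m v k r t))
        (iota 0 j))
     (has (fun t => (i <= t) &&
          ((step_code c u m v k r t != 1) && qle_code x (step_code c u m v k r t))) (iota 0 j))
     (has (fun t => (i <= t) &&
          ((step_code c u m v k r t != 1) && ~~ qle_code x (step_code c u m v k r t))) (iota 0 j))
     (has (fun t => (i <= t) && is_final c (dig (states c) r t)) (iota 0 j))].

(** A run up to position [j] passes through [j.+1] states, which are the digits of [r]. *)
Definition one_loop_code c x u m v k i j :=
  has (fun r => run_accepted_code c x u m v k i j r) (iota 0 (states c ^ j.+1)).

Definition lasso_code c x u m v k B :=
  has (fun l => one_loop_code c x u m v k (m + l.+1 * k) (m + l.+1 * k + l.+1 * k)) (iota 0 B).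

(** Code 0 is the threshold -oo, at which any two behaviors agree. Periods are positive, hence
    [k.+1]. *)
Definition equiv_code c c' x B := (x == 0) ||
  all (fun m => all (fun k => all (fun u => all (fun v =>
    lasso_code c x u m v k.+1 B == lasso_code c' x u m v k.+1 B)
      (iota 0 (a ^ k.+1))) (iota 0 (a ^ m))) (iota 0 B)) (iota 0 B.+1).

(* The number of pairs of profiles; [2 ^ 4] counts the feature sets. *)
Definition profile_bound c c' :=
  2 ^ (states c * states c * 2 ^ 4) * 2 ^ (states c' * states c' * 2 ^ 4).

Definition all_weights_equiv_code d c c' B :=
  all (fun p => all (fun b => all (fun q => equiv_code c c' (weight_code a d p b q) B)
    (iota 0 (states d))) (iota 0 a)) (iota 0 (states d)).

(** Code 1 is the threshold +oo; the weights of both automata supply the other thresholds of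
    [behavior_eq]. *)
Definition decide_code c c' :=
  [&& equiv_code c c' 1 (profile_bound c c'),
      all_weights_equiv_code c c c' (profile_bound c c') &
      all_weights_equiv_code c' c c' (profile_bound c c')].

Ltac code_step :=
  first [ compute_step | computable_leaf | quantifier_step
        | lazymatch goal with
          | |- computable _ (fun v => dig _ _ _) => apply: computable_dig
          | |- computable _ (fun v => states _) => apply: computable_states
          | |- computable _ (fun v => code_nth _ _) => apply: computable_code_nth
          | |- computable _ (fun v => weight_code _ _ _ _ _) => apply: computable_weight
          | |- computableb _ (fun v => is_init _ _) => apply: computableb_init
          | |- computableb _ (fun v => is_final _ _) => apply: computableb_final
          end ].

Lemma computableb_qle_code n x y : computable n x -> computable n y ->
  computableb n (fun v => qle_code (x v) (y v)).
Proof.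
move=> cx cy; rewrite /qle_code /code_num /code_den /pos_part /neg_part.
by repeat code_step.
Qed.

Lemma computable_step_code n c u m v k r t :
  computable n c -> computable n u -> computable n m -> computable n v -> computable n k ->
  computable n r -> computable n t ->
  computable n (fun s => step_code (c s) (u s) (m s) (v s) (k s) (r s) (t s)).
Proof. by move=> *; rewrite /step_code /letter_code; repeat code_step. Qed.

Ltac code_step2 :=
  first [ code_step
        | lazymatch goal with
          | |- computable _ (fun v => step_code _ _ _ _ _ _ _) => apply: computable_step_code
          | |- computableb _ (fun v => qle_code _ _) => apply: computableb_qle_code
          end ].

Lemma computableb_run_accepted n c x u m v k i j r :
  computable n c -> computable n x -> computable n u -> computable n m -> computable n v ->
  computable n k -> computable n i -> computable n j -> computable n r ->
  computableb n (fun s =>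
    run_accepted_code (c s) (x s) (u s) (m s) (v s) (k s) (i s) (j s) (r s)).
Proof.
by move=> *; rewrite /run_accepted_code /acceptance; case: (K); repeat code_step2.
Qed.

Lemma computableb_lasso n c x u m v k B :
  computable n c -> computable n x -> computable n u -> computable n m -> computable n v ->
  computable n k -> computable n B ->
  computableb n (fun s => lasso_code (c s) (x s) (u s) (m s) (v s) (k s) (B s)).
Proof.
move=> *; rewrite /lasso_code /one_loop_code.
by repeat first [code_step | apply: computableb_run_accepted].
Qed.

Lemma computableb_equiv n c c' x B :
  computable n c -> computable n c' -> computable n x -> computable n B ->
  computableb n (fun s => equiv_code (c s) (c' s) (x s) (B s)).
Proof. by move=> *; rewrite /equiv_code; repeat first [code_step | apply: computableb_lasso]. Qed.

Lemma computableb_decide : computableb 2 (fun s => decide_code (head 0 s) (head 0 (behead s))).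
Proof.
rewrite /decide_code /all_weights_equiv_code /profile_bound.
by repeat first [code_step | apply: computableb_equiv].
Qed.
End Formula.

(** * Correctness of the decision formula *)

Lemma dig_expansion b (f : nat -> nat) L : (forall t, t < L -> f t < b) ->
  exists2 z, z < b ^ L & forall t, t < L -> dig b z t = f t.
Proof.
elim: L f => [|L IH] f fb; first by exists 0.
have [t tL|z zL zf] := IH (fun t => f t.+1); first exact: fb.
have b0 : 0 < b by apply: leq_ltn_trans (fb 0 (ltn0Sn L)).
have f0 := fb 0 (ltn0Sn L).
exists (f 0 + z * b).
  rewrite expnSr; have : z.+1 * b <= b ^ L * b by rewrite leq_mul2r zL orbT.
  by rewrite mulSn; apply: leq_trans; rewrite ltn_add2r.
case=> [_|t tL]; first by rewrite /dig expn0 divn1 addnC modnMDl modn_small.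
by rewrite -zf // /dig expnS divnMA addnC divnMDl // (divn_small f0) addn0.
Qed.

Lemma has_shift_iota (P : pred nat) i j : i <= j ->
  has (fun t => (i <= t) && P t) (iota 0 j) = has P (index_iota i j).
Proof.
move=> ij; apply/hasP/hasP => -[t].
  by rewrite mem_iota => tj /andP[it Pt]; exists t => //; rewrite mem_index_iota it.
by rewrite mem_index_iota => /andP[it tj] Pt; exists t; rewrite ?mem_iota ?it.
Qed.

Lemma pickle_eq0 y : (pickle y == 0) = (y == QNinf).
Proof. by rewrite -pickle_qninf (inj_eq (pcan_inj pickleK)). Qed.

Lemma pickle_eq1 y : (pickle y == 1) = (y == QInf).
Proof. by rewrite -pickle_qinf (inj_eq (pcan_inj pickleK)). Qed.

Section Correctness.
Variables (A : finType) (a0 : A) (K : kind).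

Definition word z t : A := nth a0 (enum A) (dig #|A| z t).

Lemma card_pos : 0 < #|A|. Proof. by apply/card_gt0P; exists a0. Qed.

Lemma index_word z t : index (word z t) (enum A) = dig #|A| z t.
Proof. by rewrite index_uniq ?enum_uniq // -cardE ltn_pmod // card_pos. Qed.

Lemma letter_codeE u m v k t :
  letter_code #|A| u m v k t = index (lasso (word u) m (word v) k t) (enum A).
Proof. by rewrite /letter_code /lasso; case: ifP; rewrite index_word. Qed.

Lemma word_expansion (f : nat -> A) L :
  exists2 z, z < #|A| ^ L & forall t, t < L -> word z t = f t.
Proof.
have [t _|z zL zf] := @dig_expansion #|A| (fun t => index (f t) (enum A)) L.
  by rewrite cardE index_mem mem_enum.
by exists z => // t tL; rewrite /word zf // nth_index // mem_enum.
Qed.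

Section OneAutomaton.
Variables (N : wba A) (x : qbar).
Notation M := (threshold_muller K N x).

Lemma run_accepted_codeE u m v k i j r (q : nat -> 'I_(projT1 N)) : i <= j ->
  (forall t, t <= j -> dig (states (code N)) r t = q t) ->
  run_accepted_code #|A| K (code N) (pickle x) u m v k i j r =
  [&& q 0 \in wba_init N, q i == q j &
      macc M (features (M := M) q (lasso (word u) m (word v) k) 0 j)
             (features (M := M) q (lasso (word u) m (word v) k) i j)].
Proof.
move=> ij rq; set w := lasso _ _ _ _.
(* Unification must not unfold the encoding. *)
have [f stepE [ninfE infE qleE]] : exists2 f : qbar -> nat,
    forall t, t < j -> step_code #|A| (code N) u m v k r t = f (wba_wt N (q t, w t, q t.+1)) &
    [/\ forall y, (f y == 0) = (y == QNinf), forall y, (f y == 1) = (y == QInf) &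
        forall y, qle_code (pickle x) (f y) = qle x y].
  exists pickle; first by move=> t tj;
    rewrite /step_code letter_codeE !rq ?weight_code_code // ltnW.
  by split=> y; [exact: pickle_eq0|exact: pickle_eq1|exact: qle_codeE].
rewrite /run_accepted_code; move: (pickle x) qleE => px qleE.
rewrite rq // is_init_code; congr (_ && _).
rewrite !rq //; congr (_ && _).
have featE c i' : c < 4 -> i' <= j -> (feature c \in features (M := M) q w i' j) =
    has (fun t => (i' <= t) && nth false
      (feature_bits x (wba_wt N (q t, w t, q t.+1)) (q t \in wba_fin N)) c)
      (iota 0 j).
  move=> c4 ij'; rewrite has_shift_iota // [LHS]inE; apply: eq_has => t.
  by rewrite [LHS]inE inordK.
have E (P Q : pred nat) : (forall t, t < j -> P t = Q t) -> has P (iota 0 j) = has Q (iota 0 j).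
  by move=> PQ; apply: eq_in_has => t; rewrite mem_iota => /andP[_ /PQ].
congr acceptance; rewrite featE //; apply: E => t tj.
- by rewrite stepE.
- rewrite (stepE t tj). rewrite infE. rewrite qleE. done.
- rewrite (stepE t tj). rewrite ?infE. rewrite qleE. done.
- rewrite (stepE t tj). rewrite ?infE. rewrite qleE. done.
- rewrite (stepE t tj). rewrite ?infE. rewrite qleE. done.
- rewrite rq; last exact: ltnW. by rewrite is_final_code.
Qed.

Lemma one_loop_codeP u m v k i j : i <= j ->
  one_loop_code #|A| K (code N) (pickle x) u m v k i j <->
  one_loop M (lasso (word u) m (word v) k) i j.
Proof.
move=> ij; split.
  case/hasP=> r; rewrite mem_iota states_code add0n => /andP[_ rj].
  (* Without states the search range [0 ^ j.+1] is empty, so the existence of [r] provides a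
     state. *)
  have n0 : 0 < projT1 N by move: rj; case: (projT1 N) => //; rewrite exp0n.
  pose q t : 'I_(projT1 N) := Ordinal (ltn_pmod (r %/ projT1 N ^ t) n0).
  rewrite (@run_accepted_codeE _ _ _ _ _ _ _ q) //; last by rewrite states_code.
  by case/and3P=> qI /eqP qij acc; exists q.
move=> [q [qI qij acc]].
have [t _|r rj rq] := @dig_expansion (projT1 N) (fun t => q t) j.+1; first exact: ltn_ord.
apply/hasP; exists r; first by rewrite mem_iota states_code.
rewrite (@run_accepted_codeE _ _ _ _ _ _ _ q) //; last by rewrite states_code.
by rewrite qI acc andbT; apply/eqP.
Qed.

Lemma lasso_codeP u m v k B :
  lasso_code #|A| K (code N) (pickle x) u m v k B <->
  lasso_accepted M (lasso (word u) m (word v) k) m k B.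
Proof.
split=> [/hasP[l]|[[|l] [//= _ lB acc]]].
  rewrite mem_iota => /andP[_ lB] acc; exists l.+1; split=> //.
  by apply/one_loop_codeP => //; exact: leq_addr.
apply/hasP; exists l; first by rewrite mem_iota.
by apply/one_loop_codeP => //; exact: leq_addr.
Qed.
End OneAutomaton.

Lemma equiv_codeP (N N' : wba A) x B : x <> QNinf ->
  #|{: {set 'I_(projT1 N) * 'I_(projT1 N) * {set 'I_4}} *
       {set 'I_(projT1 N') * 'I_(projT1 N') * {set 'I_4}}}| <= B ->
  equiv_code #|A| K (code N) (code N') (pickle x) B <->
  forall w, qle x (behavior K N w) <-> qle x (behavior K N' w).
Proof.
move=> xN leB.
have -> : (forall w, qle x (behavior K N w) <-> qle x (behavior K N' w)) <->
    (forall w, accepts (threshold_muller K N x) w <-> accepts (threshold_muller K N' x) w).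
  by split=> H w; have := H w; rewrite !threshold_accepts.
rewrite (@accepts_equiv _ _ (threshold_muller K N x) (threshold_muller K N' x) B leB).
rewrite /equiv_code pickle_eq0 (introF eqP xN) orFb.
split=> [/allP H u m v [//|k] mB _ kB|H].
  (* The lasso depends only on the first [m] letters of [u] and the first [k.+1] letters of [v], so
     numbers in the search range represent it. *)
  have [zu zuP uE] := word_expansion u m; have [zv zvP vE] := word_expansion v k.+1.
  have -> : lasso u m v k.+1 = lasso (word zu) m (word zv) k.+1.
    apply: functional_extensionality => t; rewrite /lasso; case: ltnP => tm; first by rewrite uE.
    by rewrite vE // ltn_mod.
  have /(H m)/allP/(_ k) : m \in iota 0 B.+1 by rewrite mem_iota.
  rewrite mem_iota => /(_ kB)/allP/(_ zu); rewrite mem_iota => /(_ zuP)/allP/(_ zv).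
  by rewrite mem_iota => /(_ zvP)/eqP eqc; rewrite -!lasso_codeP eqc.
apply/allP => m; rewrite mem_iota => mB; apply/allP => k; rewrite mem_iota => kB.
apply/allP => u _; apply/allP => v _; apply/eqP; apply/idP/idP => /lasso_codeP acc;
  by apply/lasso_codeP; apply/(H (word u) m (word v) k.+1 mB isT kB).
Qed.

Lemma card_profiles n n' :
  #|{: {set 'I_n * 'I_n * {set 'I_4}} * {set 'I_n' * 'I_n' * {set 'I_4}}}| =
  2 ^ (n * n * 2 ^ 4) * 2 ^ (n' * n' * 2 ^ 4).
Proof.
have card_set (T : finType) : #|{set T}| = 2 ^ #|T|.
  by rewrite -(cardsT T) -card_powerset powersetT cardsT.
by rewrite card_prod !card_set !card_prod !card_set !card_ord.
Qed.

Lemma all_weights_equiv_codeP (N1 N N' : wba A) B :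
  all_weights_equiv_code #|A| K (code N1) (code N) (code N') B <->
  forall y, equiv_code #|A| K (code N) (code N') (pickle (wba_wt N1 y)) B.
Proof.
split=> [/allP H [[p b] q]|H].
  have /H/allP/(_ (index b (enum A))) : val p \in iota 0 (states (code N1)).
    by rewrite mem_iota states_code ltn_ord.
  rewrite mem_iota cardE index_mem mem_enum => /(_ isT)/allP/(_ (val q)).
  by rewrite mem_iota states_code ltn_ord -cardE weight_code_code => /(_ isT).
apply/allP => p; rewrite mem_iota states_code => pn; apply/allP => b; rewrite mem_iota => bA.
apply/allP => q; rewrite mem_iota => qn.
have := H (Ordinal pn, nth a0 (enum A) b, Ordinal qn).
by rewrite -weight_code_code /= index_uniq ?enum_uniq // -cardE.
Qed.

Lemma decide_codeP (N N' : wba A) : decide_code #|A| K (code N) (code N') <->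
  forall w, behavior K N w = behavior K N' w.
Proof.
have leB : #|{: {set 'I_(projT1 N) * 'I_(projT1 N) * {set 'I_4}} *
       {set 'I_(projT1 N') * 'I_(projT1 N') * {set 'I_4}}}| <= profile_bound (code N) (code N').
  by rewrite card_profiles /profile_bound !states_code.
pose B := profile_bound (code N) (code N').
have equivP x : equiv_code #|A| K (code N) (code N') (pickle x) B <->
    (x <> QNinf -> forall w, qle x (behavior K N w) <-> qle x (behavior K N' w)).
  case: (classic (x = QNinf)) => [->|xN]; first by split.
  by rewrite (equiv_codeP xN leB); split=> // /(_ xN).
rewrite /decide_code -pickle_qinf; split.
  case/and3P=> eI /all_weights_equiv_codeP e1 /all_weights_equiv_codeP e2 w.
  apply/behavior_eq => x + xN; rewrite inE mem_cat => /or3P[/eqP xE|/mapP[y _ xE]|/mapP[y _ xE]].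
  - by subst x; apply: (proj1 (equivP _) eI).
  - by subst x; apply: (proj1 (equivP _) (e1 y)).
  - by subst x; apply: (proj1 (equivP _) (e2 y)).
move=> eqb; apply/and3P; split;
  [apply/equivP|apply/all_weights_equiv_codeP => y; apply/equivP..] => _ w;
  by rewrite eqb.
Qed.
End Correctness.

Theorem theorem8 (A : finType) (K : kind) :
  exists e : recfun, forall N N' : wba A,
    ((forall w, behavior K N w = behavior K N' w) ->
       eval e [:: code N; code N'] 1) /\
    (~ (forall w, behavior K N w = behavior K N' w) ->
       eval e [:: code N; code N'] 0).
Proof.
(* Over an empty alphabet there are no infinite words, so all behaviors agree and the constant 1
   decides. *)
case: (pickP (@predT A)) => [a0 _|noA]; last first.
  have [e eP] := computable_const 2 1; exists e => N N'; split=> [_|]; first exact: eP.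
  by case=> w; have := noA (w 0).
have [e eP] := computableb_decide #|A| K; exists e => N N'.
have := eP [:: code N; code N'] erefl; have dP := decide_codeP a0 K N N'.
by case: (boolP (decide_code _ _ _ _)) => /= [/dP|/negP/dP] d; split=> // nd; case: d.
Qed.
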